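(* Let $p\in[2,n)$, let $\Omega\subset\mathbb{R}^n$ be a bounded domain, and let $\mu$ be a nonnegative finite Radon measure on $\Omega$. Let $x_0\in\Omega$, $m\in(0,n-p)$ and $r_0>0$ with $B(x_0,3r_0)\subset\Omega$, and assume that there is a constant $C_0>0$ such that $$\mu(B(x_0,t))\leq C_0\,t^m\quad\text{for all } t\in(0,3r_0).$$ Then, for every sufficiently small $\varepsilon>0$, there are a subset $E\subset\Omega$ which is $p$-thin at $x_0$ and a constant $C>0$ such that $$W^{\mu}_{1,p}(x,r_0)\leq C\,|x-x_0|^{-\frac{n-p-m+\varepsilon}{p-1}}\quad\text{for all } x\in\Omega\setminus E.$$
   Context: Here $n\geq3$, and $B(x,t)$ is the Euclidean ball of radius $t$ centered at $x$. For a nonnegative Radon measure $\mu$, the Wolff potential is $$W^{\mu}_{1,p}(x,r)=\int_0^r\left(\frac{\mu(B(x,t))}{t^{n-p}}\right)^{\frac1{p-1}}\frac{dt}{t},$$ where $\mu$ is regarded as zero outside $\Omega$. The right-hand side of the estimate is $+\infty$ at $x=x_0$. $p$-capacity: for a compact subset $K$ of a domain (open set) $D\subset\mathbb{R}^n$, $$cap_p(K,D)=\inf\left\{\int_D|\nabla u|^p\,dx:\ u\in C_0^\infty(D),\ u\geq1\text{ on }K\right\},$$ and for an arbitrary subset $F\subset D$, $$cap_p(F,D)=\inf_{G\text{ open},\,F\subset G\subset D}\ \ \sup_{K\text{ compact},\,K\subset G}cap_p(K,D).$$ $p$-thinness: let $$\omega_i(x_0)=\{x\in\mathbb{R}^n:2^{-i-1}\leq|x-x_0|\leq2^{-i}\},\qquad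 \Omega_i(x_0)=\{x\in\mathbb{R}^n:2^{-i-2}<|x-x_0|<2^{-i+1}\}.$$ For $p\in(1,n)$, a set $E\subset\mathbb{R}^n$ is said to be $p$-thin at $x_0\in\mathbb{R}^n$ if $$\sum_{i=1}^\infty\frac{cap_p(E\cap\omega_i(x_0),\Omega_i(x_0))}{cap_p(\partial B(x_0,2^{-i}),B(x_0,2^{-i+1}))}<+\infty.$$ *)

(* Defs.v *)
(* R^n is 'rV[R]_n with its library topology.  The library norm `|x| on it is *)
(* the sup norm, hence the separate Euclidean norm enorm and ball eball.      *)
From HB Require Import structures.
From mathcomp Require Import all_boot all_order all_algebra.
From mathcomp Require Import all_classical all_reals all_analysis.
From mathcomp Require Import measurable_realfun.

Set Implicit Arguments.
Unset Strict Implicit.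
Unset Printing Implicit Defensive.

Import Order.TTheory GRing.Theory Num.Theory.
Import numFieldNormedType.Exports.

Local Open Scope classical_set_scope.
Local Open Scope ring_scope.

(* R^n with its Borel sigma-algebra *)
Notation borelRn R n := (g_sigma_algebraType (open : set (set 'rV[R]_n))).

Section lebesgue_Rn.
Context {R : realType}.

Definition row_cons n (p : measurableTypeR R * borelRn R n) : borelRn R n.+1 :=
  row_mx (p.1)%:M (p.2 : 'rV[R]_n) : 'rV[R]_(1 + n).

Definition row_uncons n (v : borelRn R n.+1) :
    measurableTypeR R * borelRn R n :=
  ((v : 'rV[R]_n.+1) 0 0, rsubmx (v : 'rV[R]_(1 + n))).

Lemma row_consK n : cancel (@row_cons n) (@row_uncons n).
Proof.
move=> [x v]; rewrite /row_cons /row_uncons row_mxKr; congr (_, _).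
have := row_mxEl (x%:M : 'M[R]_1) v 0 0; rewrite [X in _ = X]mxE mulr1n => h.
by apply: etrans h; congr (row_mx _ _ _ _); apply/val_inj.
Qed.

Lemma row_unconsK n : cancel (@row_uncons n) (@row_cons n).
Proof.
move=> v; rewrite /row_cons /row_uncons -[RHS](@hsubmxK _ 1 1 n)/=.
apply: (congr1 (fun a : 'M[R]_1 => row_mx a (rsubmx (v : 'rV[R]_(1 + n))))).
apply/matrixP => i j; rewrite !ord1 !mxE/= mulr1n.
by congr (v _ _); apply/val_inj.
Qed.

Lemma row_consl n (p : measurableTypeR R * borelRn R n) i :
  (row_cons p : 'rV[R]_(1 + n)) i (lshift n (0 : 'I_1)) = p.1.
Proof. by rewrite /row_cons row_mxEl mxE ord1 eqxx mulr1n. Qed.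

Lemma row_consr n (p : measurableTypeR R * borelRn R n) i j :
  (row_cons p : 'rV[R]_(1 + n)) i (rshift 1 j) = (p.2 : 'rV[R]_n) i j.
Proof. by rewrite /row_cons row_mxEr. Qed.

Lemma row_cons_ball n (w : 'rV[R]_n.+1) (e : R) :
  @row_cons n @^-1` ball w e =
  ball (row_uncons w).1 e `*` ball ((row_uncons w).2 : 'rV[R]_n) e.
Proof.
rewrite -{1}(row_unconsK w); move: (row_uncons w) => p.
apply/seteqP; split => [q|q].
  move=> [e0 h]; split => /=.
    by have := h 0 (lshift n (0 : 'I_1)); rewrite !row_consl.
  by split=> // i j; have := h i (rshift 1 j); rewrite !row_consr.
move=> [/= ha [e0 hb]]; split => // i.
change (forall j : 'I_(1 + n), ball ((row_cons p : 'rV[R]_(1 + n)) i j) e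
  ((row_cons q : 'rV[R]_(1 + n)) i j)).
move=> j; case: (split_ordP j) => k ->; last by rewrite !row_consr.
by rewrite (ord1 k) !row_consl.
Qed.

Lemma open_rV_bigcup_ball n (G : set 'rV[R]_n) : open G ->
  G = \bigcup_(qk : 'rV[rat]_n * nat)
        (if `[< ball (map_mx (@ratr R) qk.1) qk.2.+1%:R^-1 `<=` G >]
         then ball (map_mx (@ratr R) qk.1 : 'rV[R]_n) qk.2.+1%:R^-1 else set0).
Proof.
move=> oG; apply/seteqP; split => [x Gx|x [qk _]]; last first.
  by case: asboolP => // h /h.
have : nbhs x G by apply: open_nbhs_nbhs.
move=> /nbhs_ballP[e /= e0 xeG].
have [k ke] : exists k : nat, k.+1%:R^-1 < e / 2.
  have := near_infty_natSinv_lt (PosNum (divr_gt0 e0 (ltr0n R 2))).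
  by move=> [N _ /(_ N (leqnn N))] h; exists N.
have k0 : 0 < k.+1%:R^-1 :> R by rewrite invr_gt0.
have hq (j : 'I_n) : exists q : rat, ball (x 0 j) k.+1%:R^-1 (ratr q : R).
  have [y [+ [q _ qy]]] := @dense_rat R (ball (x 0 j) k.+1%:R^-1)
    (ex_intro _ (x 0 j) (ballxx (x 0 j) k0)) (ball_open (x 0 j) (k.+1%:R^-1)).
  by rewrite -qy; exists q.
pose q : 'rV[rat]_n := \row_j projT1 (cid (hq j)).
have xq : ball (x : 'rV[R]_n) k.+1%:R^-1 (map_mx (@ratr R) q).
  split => // i j; rewrite !mxE !ord1.
  exact: (projT2 (cid (hq j))).
exists (q, k) => //=; case: asboolP => [_|]; first exact: ball_sym.
case=> y qy; apply: xeG; rewrite (splitr e).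
apply: (@ball_triangle _ _ (map_mx (@ratr R) q)).
  by apply: le_ball xq; exact: ltW.
by apply: le_ball qy; exact: ltW.
Qed.

Lemma measurable_row_cons n : measurable_fun setT (@row_cons n).
Proof.
apply: (@measurability _ _ _ (borelRn R n.+1) _ _ open) => //.
move=> _ [G oG <-]; rewrite setTI [X in _ @^-1` X](open_rV_bigcup_ball oG).
rewrite preimage_bigcup; apply: countable_bigcupT_measurable; first exact: countableP.
move=> [q k]; case: ifPn => _ /=; last by rewrite preimage_set0.
rewrite row_cons_ball; apply: measurableX; first exact: (open_measurable (ball_open _ _)).
apply: sub_sigma_algebra; exact: (ball_open (_ : 'rV[R]_n)).
Qed.

Lemma measurable_coord n (i : 'I_n) :
  measurable_fun setT (fun v : borelRn R n => (v : 'rV[R]_n) 0 i : measurableTypeR R).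
Proof.
apply: (measurability _ (RGenOpens.measurableE R)) => //.
move=> _ [_ [a [b ->]] <-]; rewrite setTI; apply: sub_sigma_algebra.
suff : open ((fun v : 'rV[R]_n => v 0 i) @^-1` `]a, b[) by [].
apply: open_comp; last exact: interval_open.
by move=> v _; exact: coord_continuous.
Qed.

Lemma measurable_row_uncons n : measurable_fun setT (@row_uncons n).
Proof.
apply/measurable_fun_pairP; split; first exact: (measurable_coord (0 : 'I_n.+1)).
apply: (@measurability _ _ _ (borelRn R n) _ _ open) => //.
move=> _ [G oG <-]; rewrite setTI; apply: sub_sigma_algebra.
suff : open ((fun v : 'rV[R]_n.+1 => rsubmx (v : 'rV[R]_(1 + n))) @^-1` G).
  by [].
apply: open_comp oG => v _ A /nbhs_ballP[e /= e0 eA].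
apply/nbhs_ballP; exists e => //= w [_ vw]; apply: eA; split => // i j.
by rewrite !mxE; exact: vw.
Qed.

Section pushforward_row_cons.
Local Open Scope ereal_scope.
Variables (n : nat) (m : {sigma_finite_measure set (borelRn R n) -> \bar R}).

Definition lebesgue_step : set (borelRn R n.+1) -> \bar R :=
  pushforward (lebesgue_measure \x m) (@row_cons n).

Let lebesgue_stepM : {measure set (borelRn R n.+1) -> \bar R} :=
  measure_function_pushforward__canonical__measure_function_Measure
    (lebesgue_measure \x m) (@measurable_row_cons n).

HB.instance Definition _ := Measure.copy lebesgue_step lebesgue_stepM.

Let lebesgue_step_sigma_finite : sigma_finite setT lebesgue_step.
Proof.
have /sigma_finiteP[F [FT ndF Foo]] :=
  sigma_finiteT (@lebesgue_measure R : {sigma_finite_measure set _ -> \bar R}).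
have /sigma_finiteP[G [GT ndG Goo]] := sigma_finiteT m.
exists (fun k => @row_uncons n @^-1` (F k `*` G k)).
  rewrite -preimage_bigcup; apply/esym/seteqP; split => // v _ /=.
  move: (row_uncons v) => [a b].
  have [i _ Fa] : (\bigcup_i F i) a by rewrite -FT.
  have [j _ Gb] : (\bigcup_i G i) b by rewrite -GT.
  exists (maxn i j) => //; split => /=.
    by move: a Fa; exact/subsetPset/ndF/leq_maxl.
  by move: b Gb; exact/subsetPset/ndG/leq_maxr.
move=> k; have [mF Fk] := Foo k; have [mG Gk] := Goo k.
split; first by rewrite -[X in measurable X]setTI; apply: measurable_row_uncons;
  [exact: measurableT|exact: measurableX].
rewrite /lebesgue_step /pushforward -comp_preimage.
rewrite (_ : _ \o _ = id); last by apply/funext => p /=; exact: row_consK.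
by rewrite preimage_id product_measure1E// lte_mul_pinfty// ge0_fin_numE.
Qed.

HB.instance Definition _ := Measure_isSigmaFinite.Build _ _ _ lebesgue_step
  lebesgue_step_sigma_finite.

End pushforward_row_cons.

(* n-dimensional Lebesgue measure on the Borel sets: the n-fold product of    *)
(* the one-dimensional one (see lebesgue_Rn_box for its values on boxes).     *)
Fixpoint lebesgue_Rn n : {sigma_finite_measure set (borelRn R n) -> \bar R} :=
  if n is n'.+1 then lebesgue_step (lebesgue_Rn n')
  else \d_(0 : borelRn R 0).

Lemma lebesgue_Rn_box n (A : 'I_n -> set R) :
  (forall i, measurable (A i)) ->
  lebesgue_Rn n [set v : 'rV[R]_n | forall i, A i (v 0 i)] =
  (\prod_(i < n) lebesgue_measure (A i))%E.
Proof.
elim: n A => [A _|n IH A mA].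
  by rewrite big_ord0 /= /dirac indicE mem_set// => -[].
have mB : measurable
    ([set v : 'rV[R]_n | forall i, A (lift ord0 i) (v 0 i)] : set (borelRn R n)).
  rewrite (_ : mkset _ = \bigcap_(i : 'I_n)
    ((fun v : borelRn R n => (v : 'rV[R]_n) 0 i) @^-1` A (lift ord0 i))).
    apply: fin_bigcap_measurable; first exact: finite_finset.
    move=> i _; rewrite -[X in measurable X]setTI.
    by apply: measurable_coord => //; exact: mA.
  by apply/seteqP; split => v /= h i; [move=> _|]; exact: h.
rewrite big_ord_recl -(IH _ (fun i => mA (lift ord0 i))).
rewrite -product_measure1E//; last exact: mA.
rewrite [LHS]/= /lebesgue_step /pushforward; congr ((_ \x _)%E _).
apply/seteqP; split => p /=.
  move=> h; split=> [|i].
    have := h (lshift n (0 : 'I_1)); rewrite row_consl.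
    by rewrite (_ : lshift n 0 = ord0)//; apply/val_inj.
  have := h (rshift 1 i); rewrite row_consr.
  by rewrite (_ : rshift 1 i = lift ord0 i)//; apply/val_inj.
move=> [h0 h] i; case: (unliftP ord0 i) => [j|] ->.
  have := h j; rewrite -(row_consr p 0).
  by rewrite (_ : rshift 1 j = lift ord0 j)//; apply/val_inj.
move: h0; rewrite -(row_consl p 0).
by rewrite (_ : lshift n 0 = ord0)//; apply/val_inj.
Qed.

End lebesgue_Rn.

Section capacity.
Context {R : realType} {n : nat}.
Implicit Types (x : 'rV[R]_n) (u : 'rV[R]_n -> R) (D E F G K : set 'rV[R]_n).

Definition enorm x : R := Num.sqrt (\sum_(i < n) x 0 i ^+ 2).

Definition eball x (t : R) : set 'rV[R]_n := [set y | enorm (y - x) < t].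

Definition boundary E : set 'rV[R]_n := closure E `\` interior E.

Definition pderiv (i : 'I_n) u : 'rV[R]_n -> R :=
  fun x => 'D_(delta_mx 0 i : 'rV[R]_n) u x.

Definition grad u x : 'rV[R]_n := \row_(i < n) pderiv i u x.

(* infinitely differentiable: the iterated partial derivatives of all orders  *)
(* are (Frechet) differentiable everywhere                                    *)
Definition smooth u :=
  forall (s : seq 'I_n) x, differentiable (foldr pderiv u s) x.

Definition supp u : set 'rV[R]_n := closure [set x | u x != 0].

(* C_0^infty(D), its elements being extended by 0 to R^n *)
Definition test_fun D u := [/\ smooth u, compact (supp u) & supp u `<=` D].

Definition energy (p : R) D u : \bar R :=
  (\int[lebesgue_Rn n]_(x in D) (enorm (grad u x) `^ p)%:E)%E.

Definition cap_compact (p : R) K D : \bar R :=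
  ereal_inf [set energy p D u |
    u in [set u | test_fun D u /\ forall x, K x -> 1 <= u x]].

Definition cap (p : R) F D : \bar R :=
  ereal_inf [set ereal_sup [set cap_compact p K D |
                            K in [set K | compact K /\ K `<=` G]] |
    G in [set G | [/\ open G, F `<=` G & G `<=` D]]].

Definition annulus x0 (i : nat) : set 'rV[R]_n :=
  [set x | 2 ^- i.+1 <= enorm (x - x0) <= 2 ^- i].

Definition wide_annulus x0 (i : nat) : set 'rV[R]_n :=
  [set x | 2 ^- i.+2 < enorm (x - x0) < 2 * 2 ^- i].

(* For 1 < p < n the denominators are positive and finite, so the library     *)
(* conventions for dividing by 0 or +oo play no role.                         *)
Definition p_thin (p : R) E x0 : Prop :=
  (\sum_(1 <= i <oo)
     (cap p (E `&` annulus x0 i) (wide_annulus x0 i) /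
      cap_compact p (boundary (eball x0 (2 ^- i))) (eball x0 (2 * 2 ^- i)))
   < +oo)%E.

Definition radon (mu : set (borelRn R n) -> \bar R) : Prop :=
  (forall K, compact K -> (mu K < +oo)%E) /\
  (forall A : set (borelRn R n), measurable A ->
     mu A = ereal_sup [set mu K | K in [set K | compact K /\ K `<=` A]]).

(* mu is the extension by 0 to R^n of a measure given on a subset             *)
Definition wolff (mu : set (borelRn R n) -> \bar R) (p : R) x (r : R) : \bar R :=
  (\int[lebesgue_measure]_(t in `]0%R, r[)
     ((mu (eball x t) / (t `^ (n%:R - p))%:E) `^ (p - 1)^-1 / t%:E))%E.

End capacity.

(* Main.v *)
Require Import Defs.
From mathcomp Require Import all_boot all_order all_algebra.
From mathcomp Require Import all_classical all_reals all_analysis.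
From mathcomp Require Import measurable_realfun lra ring zify.

Set Implicit Arguments.
Unset Strict Implicit.
Unset Printing Implicit Defensive.

Import Order.TTheory GRing.Theory Num.Theory.
Import numFieldNormedType.Exports.
Local Open Scope classical_set_scope.
Local Open Scope ring_scope.

(** The exceptional set E is the set of points of Omega at which the estimate
fails. On the dyadic shell of radius r = 2^-i around x0, the growth of mu at x0
bounds the part of the Wolff potential that comes from radii larger than r / 4
by a multiple of r^(-(n-p-m)/(p-1)) (density_growth_sum). A point of E in this
shell, for a large enough constant C, is therefore a point where the dyadic
Wolff sum over radii at most r / 4 exceeds a multiple of
lam = L r^(-(n-p-m+eps)/(p-1)).

The main step is a weak type estimate, capacity_weak_type: the capacity of the
set of these points relative to the wide shell is at most a constant times
mu(B(x0, 2r)) / lam^(p-1). As mu(B(x0, 2r)) is at most a constant times r^m, this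
is a constant times r^(n-p+eps). Since the capacity of a sphere of radius r in
the ball of radius 2r is at least a constant times r^(n-p) (capacity_sphere_ge),
the terms of the series that defines thinness are at most a constant times
2^(-i eps), and the series converges.

The weak type estimate is proved with explicit test functions. At each dyadic
scale l, bumps are placed on a lattice of step comparable to l. The coefficient
at a lattice point c is the Wolff density (mu(B(c, l)) / l^(n-p))^(1/(p-1)), or 0
if the Wolff sum at c over scales at least l exceeds lam. The sum of these bumps
is at least a multiple of lam where the Wolff sum is large (coef_sum_ge), because
the density is large only where it was already comparably large at the preceding
scale and at nearby points. Its p-energy is at most a multiple of
lam mu(B(x0, 2r)): by a form of Wolff's inequality (wolff_pointwise, cell_energy,
level_energy), it is controlled by the sum of the coefficients times the masses
of the corresponding balls, and by the truncation a given point is charged by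
coefficients whose sum is at most a multiple of lam (coef_sum_le). Dividing the
function by a multiple of lam gives the estimate. *)

(** * A smooth bump on the line *)
Section flat_exponential.
Context {R : realType}.
Implicit Types (P : {poly R}) (x : R).

(** The family of these functions, over all polynomials P, is closed under
differentiation, which gives smoothness of the case P = 1 by induction. *)
Definition flat_exp P x : R :=
  if 0 < x then P.[x^-1] * expR (- x^-1) else 0.

(** Each monomial is dominated by one term of the exponential series. *)
Lemma poly_le_expR P : exists2 C : R, 0 <= C & forall y, 0 <= y -> `|P.[y]| <= C * expR y.
Proof.
exists (\sum_(i < size P) `|P`_i| * i`!%:R); first by apply: sumr_ge0 => i _; apply: mulr_ge0.
move=> y y0; rewrite horner_coef (le_trans (ler_norm_sum _ _ _))// mulr_suml.
apply: ler_sum => i _; rewrite normrM -mulrA ler_wpM2l// normrX ger0_norm//.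
case: i => -[|i] _ /=; first by rewrite expr0 fact0 mul1r (le_trans _ (expR_ge1Dx _))// lerDl.
rewrite mulrC -ler_pdivrMr ?ltr0n ?fact_gt0//.
by apply: le_trans (expR_ge1Dxn i y0); rewrite lerDr.
Qed.

(** At the origin, exponential decay beats the polynomial: the function is
bounded by a multiple of the square, hence has derivative 0. *)
Lemma is_derive_flat_exp P x :
  is_derive x 1 (flat_exp P) (flat_exp ('X^2 * (P - P^`())) x).
Proof.
have [x0|x0|->] := ltgtP x 0.
- rewrite {2}/flat_exp ltNge (ltW x0)/=.
  apply: (@near_eq_is_derive _ _ _ (cst 0)).
  near=> y; rewrite /flat_exp ltNge ltW//=; near: y; exact: lt_nbhsl.
- rewrite {2}/flat_exp x0.
  apply: (@near_eq_is_derive R R R (fun y : R => P.[y^-1] * expR (- y^-1))).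
    by near=> y; rewrite /flat_exp ifT//; near: y; exact: lt_nbhsr.
  have xn0 : x != 0 by rewrite gt_eqF.
  have dV : is_derive x 1 (fun y : R => y^-1) (- x ^- 2).
    by apply: is_derive_eq; [exact: is_deriveV|rewrite /GRing.scale/= mulr1].
  have d1 : is_derive x 1 (fun y : R => P.[y^-1]) (P^`().[x^-1] * (- x ^- 2)).
    exact: (@is_derive1_comp _ (horner P) (fun y => y^-1)).
  have d2 : is_derive x 1 (fun y : R => expR (- y^-1)) (expR (- x^-1) * (x ^- 2)).
    apply: (@is_derive1_comp _ expR (fun y => - y^-1)).
    by rewrite -[X in is_derive _ _ _ X]opprK; exact: is_deriveN.
  apply: (@is_derive_eq _ _ _ _ _ _ _ _ (is_deriveM d1 d2)).
  rewrite /GRing.scale/= !hornerE/= exprVn; ring.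
- rewrite {2}/flat_exp ltxx.
  have [C C0 hC] := poly_le_expR ('X^2 * P).
  have bd h : `|flat_exp P h| <= C * h ^+ 2.
    rewrite /flat_exp; case: ifPn => h0; last by rewrite normr0 mulr_ge0// sqr_ge0.
    have hn0 : h != 0 by rewrite gt_eqF.
    have hV0 : 0 <= h^-1 by rewrite invr_ge0; exact: ltW.
    have := hC _ hV0; rewrite !hornerE/= exprVn normrM ger0_norm ?invr_ge0 ?sqr_ge0// => H.
    rewrite normrM [X in _ * X]ger0_norm ?expR_ge0// expRN ler_pdivrMr ?expR_gt0//.
    have h20 : 0 < h ^+ 2 by rewrite exprn_gt0.
    have -> : C * h * h * expR h^-1 = C * expR h^-1 * h ^+ 2 by rewrite expr2; ring.
    by rewrite -(ler_pdivrMr _ _ h20) mulrC.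
  have cv : h^-1 *: (flat_exp P (h *: (1 : R) + 0) - flat_exp P 0) @[h --> 0^'] --> (0 : R).
    apply/cvgr0Pnorm_lt => e e0; near=> h.
    have hn0 : h != 0 by near: h; exact: nbhs_dnbhs_neq.
    rewrite /GRing.scale/= mulr1 addr0 {2}/flat_exp ltxx subr0 normrM normfV.
    rewrite mulrC ltr_pdivrMr ?normr_gt0//.
    apply: (le_lt_trans (bd h)).
    rewrite -[h ^+ 2]ger0_norm ?sqr_ge0// normrX expr2 mulrA ltr_pM2r ?normr_gt0//.
    rewrite (le_lt_trans (y := (C + 1) * `|h|))//.
      by rewrite ler_wpM2r// lerDl.
    rewrite mulrC -ltr_pdivlMr ?ltr_wpDl//.
    near: h; apply: dnbhs0_lt; by rewrite divr_gt0// ltr_wpDl.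
  apply: DeriveDef; first by apply/cvg_ex; exists 0.
  exact: cvg_lim cv.
Unshelve. all: by end_near. Qed.

End flat_exponential.

Section smooth_line.
Context {R : realType}.
Implicit Types f g : R -> R.

(** Differentiability k + 1 times, in recursive form so that the product rule
can be iterated by induction on k. *)
Fixpoint Ck (k : nat) f : Prop :=
  (forall x, derivable f x 1) /\ (if k is k'.+1 then Ck k' (derive1 f) else True).

Definition smooth1 f := forall k, Ck k f.

Lemma CkW k f : Ck k.+1 f -> Ck k f.
Proof. by elim: k f => [|k ih] f [df h]; split => //; exact: ih. Qed.

Lemma CkD k f g : Ck k f -> Ck k g -> Ck k (f \+ g).
Proof.
elim: k f g => [|k ih] f g cf cg.
  by split => // x; apply: derivableD; [exact: cf.1|exact: cg.1].
split=> [x|]; first by apply: derivableD; [exact: cf.1|exact: cg.1].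
rewrite (_ : derive1 (f \+ g) = derive1 f \+ derive1 g).
  by apply: ih; [exact: cf.2|exact: cg.2].
apply/funext => x; rewrite !derive1E/= derive1E deriveD//.
- by rewrite derive1E.
- exact: cf.1.
- exact: cg.1.
Qed.

Lemma CkM k f g : Ck k f -> Ck k g -> Ck k (f \* g).
Proof.
elim: k f g => [|k ih] f g cf cg.
  by split => // x; apply: derivableM; [exact: cf.1|exact: cg.1].
split=> [x|]; first by apply: derivableM; [exact: cf.1|exact: cg.1].
rewrite (_ : derive1 (f \* g) = (f \* derive1 g) \+ (g \* derive1 f)).
  by apply: CkD; apply: ih; [exact: CkW|exact: cg.2|exact: CkW|exact: cf.2].
apply/funext => x; rewrite !derive1E/= !derive1E deriveM//.
- exact: cf.1.
- exact: cg.1.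
Qed.

Lemma smooth1M f g : smooth1 f -> smooth1 g -> smooth1 (f \* g).
Proof. by move=> sf sg k; exact: CkM. Qed.

Lemma smooth1_derive f : smooth1 f -> smooth1 (derive1 f).
Proof. by move=> sf k; have [] := sf k.+1. Qed.

Lemma smooth1_derivable f : smooth1 f -> forall x, derivable f x 1.
Proof. by move=> sf; exact: (sf 0%N).1. Qed.

Lemma smooth1_cst (c : R) : smooth1 (cst c).
Proof.
move=> k; elim: k c => [|k ih] c; split => //.
rewrite (_ : derive1 (cst c) = cst 0)//; apply/funext => x; exact: derive1_cst.
Qed.

Lemma is_derive_affine f (a b x : R) : derivable f (a * x + b) 1 ->
  is_derive x 1 (fun y => f (a * y + b)) (a * derive1 f (a * x + b)).
Proof.
move=> df.
have dg : is_derive x 1 (fun y : R => a * y + b) a.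
  have dh : is_derive x 1 (fun y : R => a * y) a.
    apply: (@is_derive_eq _ _ _ _ _ _ _ _ (is_deriveM (is_derive_cst a x 1) (is_derive_id x 1))).
    by rewrite scaler0 addr0 /GRing.scale/= mulr1.
  have := is_deriveD dh (is_derive_cst b x 1); by rewrite addr0.
rewrite mulrC; apply: (@is_derive1_comp _ f (fun y => a * y + b)).
by rewrite derive1E; exact: derivableP.
Qed.

Lemma smooth1_affine f (a b : R) : smooth1 f -> smooth1 (fun x => f (a * x + b)).
Proof.
move=> sf k; elim: k f sf => [|k ih] f sf.
  split => // x; have [+ _] := is_derive_affine (smooth1_derivable sf (x := a * x + b)).
  by [].
split=> [x|].
  by have [+ _] := is_derive_affine (smooth1_derivable sf (x := a * x + b)).
rewrite (_ : derive1 (fun _ => _) = cst a \* (fun x => derive1 f (a * x + b))).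
  by apply: CkM; [exact: smooth1_cst|apply: ih; exact: smooth1_derive].
apply/funext => x; rewrite derive1E.
by have [_ ->] := is_derive_affine (smooth1_derivable sf (x := a * x + b)).
Qed.

Lemma smooth1_flat_exp (P : {poly R}) : smooth1 (flat_exp P).
Proof.
move=> k; elim: k P => [|k ih] P.
  by split => // x; have [] := is_derive_flat_exp P x.
split => [x|].
  by have [] := is_derive_flat_exp P x.
rewrite (_ : derive1 _ = flat_exp ('X^2 * (P - P^`())))//.
by apply/funext => x; rewrite derive1E; have [] := is_derive_flat_exp P x.
Qed.

(** A product of two flat exponentials facing each other. Capacities only ask
for a lower bound by 1, so the bump is rescaled and not made constant near the
origin; the common bound H comes from continuity on [-2, 2]. *)
Lemma bump1_exists : exists h : R -> R, exists2 H : R, 0 < H &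
  [/\ smooth1 h, forall x, 0 <= h x <= H, forall x, `|derive1 h x| <= H,
      forall x, `|x| <= 1 -> 1 <= h x &
      forall x, (2 <= `|x| -> h x = 0) /\ (2 < `|x| -> derive1 h x = 0)].
Proof.
pose f : R -> R := flat_exp 1.
have f0 x : 0 <= f x.
  rewrite /f /flat_exp; case: ifPn => // _; by rewrite hornerC mul1r expR_ge0.
have f1 x : 1 <= x -> expR (-1) <= f x.
  move=> x1; rewrite /f /flat_exp (lt_le_trans ltr01 x1) hornerC mul1r ler_expR.
  by rewrite lerN2 invf_le1// (lt_le_trans ltr01 x1).
have fN x : x <= 0 -> f x = 0 by move=> x0; rewrite /f /flat_exp ltNge x0.
(* On [-1, 1] both factors are at least expR (-1), hence the factor expR 2. *)
pose h x : R := (expR 2 * f (1 * x + 2)) * f ((-1) * x + 2).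
have sh : smooth1 h.
  apply: smooth1M; last by apply: smooth1_affine; exact: smooth1_flat_exp.
  apply: smooth1M; first exact: smooth1_cst.
  by apply: smooth1_affine; exact: smooth1_flat_exp.
have h0 x : 0 <= h x by rewrite !mulr_ge0// expR_ge0.
have hN x : 2 <= `|x| -> h x = 0.
  rewrite /h ler_normr => /orP[x2|x2].
    by rewrite [X in _ * X]fN ?mulr0//; lra.
  by rewrite (@fN (1 * x + 2)) ?mulr0 ?mul0r//; lra.
have h1 x : `|x| <= 1 -> 1 <= h x.
  rewrite ler_norml => /andP[xl xr]; rewrite /h.
  have e1 : (1 : R) = expR 2 * expR (-1) * expR (-1).
    by rewrite -!expRD (_ : 2 + -1 + -1 = 0 :> R) ?expR0//; ring.
  rewrite [leLHS]e1; apply: ler_pM; [by rewrite mulr_ge0 ?expR_ge0|exact: expR_ge0| |].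
    by rewrite ler_pM2l ?expR_gt0//; apply: f1; lra.
  by apply: f1; lra.
have bounded g : smooth1 g -> (forall x, 2 < `|x| -> g x = 0) ->
    exists2 M, 0 < M & forall x, `|g x| <= M.
  move=> sg gN.
  have [c _ hc] : exists2 c, c \in `[-2, 2]%R & forall t, t \in `[-2, 2]%R -> `|g t| <= `|g c|.
    apply: (@EVT_max _ (fun x => `|g x|)); first lra.
    apply: continuous_subspaceT => x; apply: continuous_comp; last exact: norm_continuous.
    by apply: differentiable_continuous; apply/derivable1_diffP; exact: smooth1_derivable.
  exists (`|g c| + 1); first by rewrite ltr_wpDl.
  move=> x; have [x2|x2] := leP `|x| 2; last by rewrite gN// normr0 addr_ge0.
  by rewrite (le_trans (hc x _)) ?lerDl// in_itv/= -ler_norml.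
have [M M0 hM] : exists2 M, 0 < M & forall x, `|h x| <= M.
  by apply: bounded => // x /ltW; exact: hN.
have hN' x : 2 < `|x| -> derive1 h x = 0.
  move=> x2; rewrite derive1E (@near_eq_derive R R R h (cst 0)) ?derive_cst//.
  have : {for x, continuous (fun y : R => `|y|)} by exact: norm_continuous.
  move=> /(_ _ (lt_nbhsr x2)) H; near=> y; apply/hN/ltW.
  by near: y.
have [M' M'0 hM'] : exists2 M, 0 < M & forall x, `|derive1 h x| <= M.
  by apply: bounded hN'; exact: smooth1_derive.
exists h, (M + M'); first exact: addr_gt0.
split => // x.
- by rewrite h0/= (le_trans (ler_norm _))// (le_trans (hM x))// lerDl ltW.
- by rewrite (le_trans (hM' x))// lerDr ltW.
- by split; [exact: hN|exact: hN'].
Unshelve. all: by end_near. Qed.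

End smooth_line.

(** * The Euclidean norm, balls and cubes *)
Section euclid.
Context {R : realType} {n : nat}.
Implicit Types x y z : 'rV[R]_n.

Lemma enorm_ge0 x : 0 <= enorm x. Proof. exact: sqrtr_ge0. Qed.

Lemma enorm_sqr x : enorm x ^+ 2 = \sum_(i < n) x 0 i ^+ 2.
Proof. by rewrite sqr_sqrtr// sumr_ge0// => i _; exact: sqr_ge0. Qed.

Lemma coord_le_enorm x i : `|x 0 i| <= enorm x.
Proof.
rewrite -sqrtr_sqr ler_sqrt ?sumr_ge0// => [|j _]; last exact: sqr_ge0.
by rewrite (bigD1 i)//= lerDl sumr_ge0// => j _; exact: sqr_ge0.
Qed.

Lemma enorm0 : enorm (0 : 'rV[R]_n) = 0.
Proof. by rewrite /enorm big1 ?sqrtr0// => i _; rewrite mxE expr0n. Qed.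

Lemma enormZ (a : R) x : enorm (a *: x) = `|a| * enorm x.
Proof.
rewrite /enorm (eq_bigr (fun i => a ^+ 2 * x 0 i ^+ 2)) => [|i _]; last by rewrite mxE exprMn.
by rewrite -mulr_sumr sqrtrM ?sqr_ge0// sqrtr_sqr.
Qed.

Lemma enormN x : enorm (- x) = enorm x.
Proof. by rewrite -scaleN1r enormZ normrN1 mul1r. Qed.

Lemma enormB x y : enorm (x - y) = enorm (y - x).
Proof. by rewrite -enormN opprB. Qed.

(** Lagrange's identity. *)
Lemma cauchy_schwarz x y :
  \sum_(i < n) x 0 i * y 0 i <= enorm x * enorm y.
Proof.
have h : (\sum_(i < n) x 0 i * y 0 i) ^+ 2 <= (enorm x * enorm y) ^+ 2.
  rewrite exprMn !enorm_sqr.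
  have : 0 <= \sum_(i < n) \sum_(j < n) (x 0 i * y 0 j - x 0 j * y 0 i) ^+ 2.
    by apply: sumr_ge0 => i _; apply: sumr_ge0 => j _; exact: sqr_ge0.
  pose A := \sum_(i < n) \sum_(j < n) x 0 i ^+ 2 * y 0 j ^+ 2.
  pose B := \sum_(i < n) \sum_(j < n) (x 0 i * y 0 i) * (x 0 j * y 0 j).
  have eA : (\sum_(i < n) x 0 i ^+ 2) * (\sum_(i < n) y 0 i ^+ 2) = A.
    by rewrite mulr_suml; apply: eq_bigr => i _; rewrite mulr_sumr.
  have eB : (\sum_(i < n) x 0 i * y 0 i) ^+ 2 = B.
    by rewrite expr2 mulr_suml; apply: eq_bigr => i _; rewrite mulr_sumr.
  rewrite eA eB.
  have -> : \sum_(i < n) \sum_(j < n) (x 0 i * y 0 j - x 0 j * y 0 i) ^+ 2 = A - B *+ 2 + A.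
    have {2}-> : A = \sum_(i < n) \sum_(j < n) x 0 j ^+ 2 * y 0 i ^+ 2 by rewrite exchange_big.
    rewrite -sumrMnl -sumrB -big_split/=; apply: eq_bigr => i _.
    rewrite -sumrMnl -sumrB -big_split/=; apply: eq_bigr => j _.
    by ring.
  by rewrite mulr2n; lra.
have [|s0] := leP (\sum_(i < n) x 0 i * y 0 i) 0.
  by move=> /le_trans; apply; rewrite mulr_ge0 ?enorm_ge0.
by rewrite -(@ler_pXn2r _ 2)// ?nnegrE ?mulr_ge0 ?enorm_ge0// ltW.
Qed.

Lemma enormD x y : enorm (x + y) <= enorm x + enorm y.
Proof.
rewrite -(@ler_pXn2r _ 2)// ?nnegrE ?addr_ge0 ?enorm_ge0//.
rewrite enorm_sqr (eq_bigr (fun i => x 0 i ^+ 2 + x 0 i * y 0 i *+ 2 + y 0 i ^+ 2)); last first.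
  by move=> i _; rewrite mxE sqrrD.
rewrite 2!big_split/= -!enorm_sqr sumrMnl sqrrD lerD2r lerD2l ler_wMn2r//.
exact: cauchy_schwarz.
Qed.

Lemma enorm_triangle z x y : enorm (x - y) <= enorm (x - z) + enorm (z - y).
Proof. by rewrite -[x - y](subrKA z); exact: enormD. Qed.

Lemma enorm_sum (I : Type) (s : seq I) (P : pred I) (v : I -> 'rV[R]_n) :
  enorm (\sum_(k <- s | P k) v k) <= \sum_(k <- s | P k) enorm (v k).
Proof.
elim/big_ind2 : _ => [|a b c d ha hb|//]; first by rewrite enorm0.
by rewrite (le_trans (enormD _ _))// lerD.
Qed.

Lemma enorm_le_coord x (M : R) : (forall i, `|x 0 i| <= M) -> enorm x <= n%:R * M.
Proof.
move=> hM; have [n0|n0] := posnP n.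
  rewrite /enorm big1 ?sqrtr0 => [|i _]; first by rewrite n0 mul0r.
  by exfalso; have := ltn_ord i; lia.
have M0 : 0 <= M by exact: le_trans (hM (Ordinal n0)).
rewrite -(@ler_pXn2r _ 2)// ?nnegrE ?mulr_ge0 ?enorm_ge0//.
rewrite enorm_sqr (@le_trans _ _ (\sum_(i < n) M ^+ 2))//.
  by apply: ler_sum => i _; rewrite -[x 0 i ^+ 2]real_normK ?num_real// lerXn2r// nnegrE.
rewrite sumr_const card_ord -[leLHS]mulr_natl exprMn ler_wpM2r ?sqr_ge0//.
by rewrite -natrX ler_nat expnS expn1 leq_pmulr.
Qed.

Lemma enorm_lipschitz x y : `|enorm x - enorm y| <= enorm (x - y).
Proof.
rewrite ler_norml; apply/andP; split.
  by rewrite lerNl opprB lerBlDr -enormB (le_trans _ (enormD _ _))// subrK.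
by rewrite lerBlDr (le_trans _ (enormD _ _))// subrK.
Qed.

Lemma enorm_continuous (a : 'rV[R]_n) : continuous (fun x : 'rV[R]_n => enorm (x - a)).
Proof.
move=> x; apply/(@cvgrPdist_lt _ _ _ _ (@nbhs_filter 'rV[R]_n x)) => e e0.
apply/nbhs_ballP.
exists (e / n.+1%:R) => /= [|y [_ xy]]; first by rewrite divr_gt0.
rewrite (le_lt_trans (enorm_lipschitz _ _))// opprB addrA subrK.
apply: (@le_lt_trans _ _ (n%:R * (e / n.+1%:R))).
  apply: enorm_le_coord => i; rewrite !mxE; exact/ltW/xy.
by rewrite mulrA ltr_pdivrMr// mulrC ltr_pM2l// ltr_nat.
Qed.

Lemma open_enorm_lt (a : 'rV[R]_n) r : open [set x : 'rV[R]_n | enorm (x - a) < r].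
Proof.
rewrite (_ : [set _ | _] = (fun x => enorm (x - a)) @^-1` [set y | y < r])//.
apply: open_comp ; last exact: open_lt.
by move=> x _; exact: enorm_continuous.
Qed.

Lemma open_enorm_gt (a : 'rV[R]_n) r : open [set x : 'rV[R]_n | r < enorm (x - a)].
Proof.
rewrite (_ : [set _ | _] = (fun x => enorm (x - a)) @^-1` [set y | r < y])//.
apply: open_comp; last exact: open_gt; move=> x _; exact: enorm_continuous.
Qed.

Lemma open_eball a (r : R) : open (eball a r : set 'rV[R]_n).
Proof. exact: open_enorm_lt. Qed.

Lemma measurable_open (A : set 'rV[R]_n) : open A -> measurable (A : set (borelRn R n)).
Proof. by move=> oA; exact: sub_sigma_algebra. Qed.

Lemma measurable_eball a (r : R) : measurable (eball a r : set (borelRn R n)).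
Proof. by apply: measurable_open; exact: open_eball. Qed.

(** Balls of the sup norm: products of intervals, so of explicit Lebesgue
measure, and the natural supports of tensor products of bumps. *)
Definition cube (c : 'rV[R]_n) (d : R) : set 'rV[R]_n :=
  [set x | forall i, `|x 0 i - c 0 i| <= d].

Lemma cube_prod (c : 'rV[R]_n) d :
  cube c d = [set v : 'rV[R]_n | forall i, `[c 0 i - d, c 0 i + d]%classic (v 0 i)].
Proof.
by apply/seteqP; split=> x h i; move: {h}(h i); rewrite /= in_itv/= ler_distl.
Qed.

Lemma closed_cube c d : closed (cube c d).
Proof.
rewrite (_ : cube c d = \bigcap_(i in [set: 'I_n])
    ((fun x : 'rV[R]_n => x 0 i) @^-1` `[c 0 i - d, c 0 i + d]%classic)).
  apply: closed_bigI => i _.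
  have /continuous_closedP : continuous (fun x : 'rV[R]_n => x 0 i).
    by move=> x; exact: coord_continuous.
  by apply; exact: itv_closed.
by rewrite cube_prod; apply/seteqP; split=> x h i; [move=> _; exact: h|exact: h].
Qed.

Lemma measurable_cube c d : measurable (cube c d : set (borelRn R n)).
Proof.
rewrite -(setCK (cube c d)); apply: measurableC; apply: measurable_open.
exact/closed_openC/closed_cube.
Qed.

Lemma compact_cube c d : compact (cube c d).
Proof.
rewrite cube_prod; apply: (@rV_compact R n (fun i => `[c 0 i - d, c 0 i + d]%classic)) => i.
exact: segment_compact.
Qed.

Lemma lebesgue_cube c d : 0 <= d -> lebesgue_Rn n (cube c d) = ((2 * d) ^+ n)%:E.
Proof.
move=> d0; rewrite cube_prod.
rewrite (@lebesgue_Rn_box R n (fun i => `[c 0 i - d, c 0 i + d]%classic)); last first.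
  by move=> i; exact: measurable_itv.
rewrite (eq_bigr (fun=> (2 * d)%:E)) => [|i _]; last first.
  rewrite lebesgue_measure_itv/= lte_fin.
  case: ltP => h; first by rewrite -EFinB; congr EFin; ring.
  have -> : d = 0 by lra.
  by rewrite mulr0.
by rewrite prodEFin prodr_const card_ord.
Qed.

Lemma enorm_cube c d x : cube c d x -> enorm (x - c) <= n%:R * d.
Proof. by move=> h; apply: enorm_le_coord => i; rewrite !mxE; exact: h. Qed.

End euclid.

(** * Smooth functions and bumps in several variables *)
Section smooth_rV.
Context {R : realType} {n : nat}.
Implicit Types (u v : 'rV[R]_n -> R) (x : 'rV[R]_n).

Lemma smooth_diff u : smooth u -> forall x, differentiable u x.
Proof. by move=> su x; exact: (su [::] x). Qed.

Lemma smooth_pderiv u i : smooth u -> smooth (pderiv i u).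
Proof. by move=> su s x; have := su (rcons s i) x; rewrite foldr_rcons. Qed.

Lemma smooth_continuous u : smooth u -> continuous u.
Proof. by move=> su x; exact/differentiable_continuous/smooth_diff. Qed.

Lemma pderivD u v i : (forall x, differentiable u x) -> (forall x, differentiable v x) ->
  pderiv i (u \+ v) = pderiv i u \+ pderiv i v.
Proof.
move=> du dv; apply/funext => x; rewrite /pderiv deriveD//; exact: diff_derivable.
Qed.

Lemma pderivZ u (k : R) i : (forall x, differentiable u x) ->
  pderiv i (k \*: u) = k \*: pderiv i u.
Proof.
move=> du; apply/funext => x; rewrite /pderiv deriveZ//; exact: diff_derivable.
Qed.

Lemma smoothD u v : smooth u -> smooth v -> smooth (u \+ v).
Proof.
move=> su sv s.
have -> : foldr pderiv (u \+ v) s = foldr pderiv u s \+ foldr pderiv v s.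
  by elim: s => //= i s ->; rewrite pderivD.
by move=> x; apply: differentiableD.
Qed.

Lemma smoothZ u (k : R) : smooth u -> smooth (k \*: u).
Proof.
move=> su s.
have -> : foldr pderiv (k \*: u) s = k \*: foldr pderiv u s.
  by elim: s => //= i s ->; rewrite pderivZ.
by move=> x; apply: differentiableZ.
Qed.

Lemma pderiv_cst (k : R) i : pderiv i (fun _ : 'rV[R]_n => k) = (fun=> 0 : R).
Proof. by apply/funext => x; rewrite /pderiv derive_cst. Qed.

Lemma smooth_cst (k : R) : smooth (fun _ : 'rV[R]_n => k).
Proof.
move=> s; have [k' ->] : exists k', foldr pderiv (fun=> k) s = (fun=> k').
  elim: s => [|i s [k' /= ->]]; first by exists k.
  by exists 0; rewrite pderiv_cst.
by move=> x; exact: differentiable_cst.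
Qed.

Lemma smooth_lincomb (I : Type) (s : seq I) (c : I -> R) (u : I -> 'rV[R]_n -> R) :
  (forall k, smooth (u k)) -> smooth (fun x => \sum_(k <- s) c k * u k x).
Proof.
move=> su; elim: s => [|k s ih].
  rewrite (_ : (fun _ => _) = fun=> 0); first exact: smooth_cst.
  by apply/funext => x; rewrite big_nil.
rewrite (_ : (fun _ => _) = (c k \*: u k) \+ (fun x => \sum_(k <- s) c k * u k x)).
  by apply: smoothD => //; exact: smoothZ.
by apply/funext => x; rewrite big_cons.
Qed.

Lemma grad_lincomb (I : Type) (s : seq I) (c : I -> R) (u : I -> 'rV[R]_n -> R) :
  (forall k, smooth (u k)) -> forall x,
  grad (fun x => \sum_(k <- s) c k * u k x) x = \sum_(k <- s) c k *: grad (u k) x.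
Proof.
move=> su x; apply/rowP => i; rewrite mxE summxE.
under [RHS]eq_bigr do rewrite !mxE.
elim: s => [|k s ih].
  rewrite big_nil (_ : (fun _ => _) = fun=> 0); first by rewrite pderiv_cst.
  by apply/funext => y; rewrite big_nil.
rewrite big_cons -ih (_ : (fun _ => _) = (c k \*: u k) \+ (fun x => \sum_(k <- s) c k * u k x)).
  rewrite pderivD ?pderivZ//; first by move=> y; exact: smooth_diff.
    by move=> y; apply: differentiableZ; exact: smooth_diff.
  by move=> y; apply: smooth_diff; exact: smooth_lincomb.
by apply/funext => y; rewrite big_cons.
Qed.

Definition tensor (f : 'I_n -> R -> R) x : R := \prod_(i < n) f i (x 0 i).

Lemma differentiable_tensor (f : 'I_n -> R -> R) x : (forall i y, derivable (f i) y 1) ->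
  differentiable (tensor f) x.
Proof.
move=> df; rewrite /tensor.
have H (s : seq 'I_n) : differentiable (fun x : 'rV[R]_n => \prod_(i <- s) f i (x 0 i)) x.
  elim: s => [|i s ih].
    rewrite (_ : (fun _ => _) = cst 1); first exact: differentiable_cst.
    by apply/funext => y; rewrite big_nil.
  rewrite (_ : (fun _ => _) = (fun y : 'rV[R]_n => f i (y 0 i)) *
      (fun y : 'rV[R]_n => \prod_(i <- s) f i (y 0 i))).
    apply: differentiableM => //.
    apply: (@differentiable_comp _ _ _ _ (fun y : 'rV[R]_n => y 0 i) (f i)).
      exact: differentiable_coord.
    exact/derivable1_diffP.
  by apply/funext => y; rewrite big_cons.
exact: H.
Qed.

(** Partial derivatives of tensor products are again tensor products, so
smoothness in several variables reduces to one variable. *)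
Lemma pderiv_tensor (f : 'I_n -> R -> R) j : (forall y, derivable (f j) y 1) ->
  pderiv j (tensor f) = tensor (fun i => if i == j then derive1 (f i) else f i).
Proof.
move=> df; apply/funext => x.
pose c := \prod_(i < n | i != j) f i (x 0 i).
have e (h : R) : tensor f (h *: delta_mx 0 j + x) = c * f j (h + x 0 j).
  rewrite /tensor (bigD1 j)//= mulrC !mxE !eqxx mulr1; congr (_ * _).
  by apply: eq_bigr => i ij; rewrite !mxE/= (negbTE ij) mulr0 add0r.
have e0 : tensor f x = c * f j (x 0 j) by have := e 0; rewrite scale0r !add0r.
rewrite [RHS]/tensor (bigD1 j)//= eqxx.
rewrite (eq_bigr (fun i => f i (x 0 i))); last by move=> i /negbTE ->.
have -> : derive1 (f j) (x 0 j) * \prod_(i < n | i != j) f i (x 0 i) = 'D_1 (c \*: f j) (x 0 j).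
  by rewrite deriveZ// derive1E mulrC.
rewrite /pderiv /derive; congr (lim _).
rewrite (_ : (fun h : R => _) = (fun h : R => h^-1 *:
    (((c \*: f j) \o shift (x 0 j)) (h *: 1) - (c \*: f j) (x 0 j)))) //.
by apply/funext => h /=; rewrite e e0 /GRing.scale/= mulr1.
Qed.

Lemma smooth_tensor (f : 'I_n -> R -> R) : (forall i, smooth1 (f i)) -> smooth (tensor f).
Proof.
move=> sf s.
suff [g sg ->] : exists2 g, forall i, smooth1 (g i) & foldr pderiv (tensor f) s = tensor g.
  by move=> x; apply: differentiable_tensor => i y; exact: smooth1_derivable.
elim: s => [|j s [g sg /= ->]]; first by exists f.
exists (fun i => if i == j then derive1 (g i) else g i).
  by move=> i; case: ifP => // _; exact: smooth1_derive.
by apply: pderiv_tensor => y; exact: smooth1_derivable.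
Qed.

End smooth_rV.

(** The tensor product of rescaled one-dimensional bumps; rescaling to size d
costs a factor 1 / d in the gradient. *)
Lemma bump_exists (R : realType) (n : nat) : exists2 H : R, 0 < H &
  exists phi : 'rV[R]_n -> R -> 'rV[R]_n -> R, forall c d, 0 < d ->
  [/\ smooth (phi c d), forall x, 0 <= phi c d x,
      forall x, cube c d x -> 1 <= phi c d x,
      forall x, ~ cube c (2 * d) x -> phi c d x = 0 /\ grad (phi c d) x = 0 &
      forall x, enorm (grad (phi c d) x) <= H / d].
Proof.
have [h [H0 H00 [sh hH h'H h1 h2]]] := @bump1_exists R.
pose H := H0 + 1.
have H1 : 1 <= H by rewrite lerDr ltW.
have H_gt0 : 0 < H by exact: lt_le_trans H1.
exists (n%:R * H ^+ n + 1).
  by rewrite ltr_wpDl// mulr_ge0 ?exprn_ge0// ltW.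
pose F (c : 'rV[R]_n) d i (t : R) : R := h (d^-1 * t + - (d^-1 * c 0 i)).
exists (fun c d => tensor (F c d)) => c d d0.
have d'0 : 0 < d^-1 by rewrite invr_gt0.
have sF i : smooth1 (F c d i) by apply: smooth1_affine.
have dF i t : derive1 (F c d i) t = d^-1 * derive1 h (d^-1 * t + - (d^-1 * c 0 i)).
  rewrite derive1E.
  by have [_ ->] := is_derive_affine (smooth1_derivable sh (x := d^-1 * t + - (d^-1 * c 0 i))).
have argE (x : 'rV[R]_n) i : `|d^-1 * x 0 i + - (d^-1 * c 0 i)| = d^-1 * `|x 0 i - c 0 i|.
  by rewrite -mulrBr normrM gtr0_norm.
have gradE x j : (grad (tensor (F c d)) x) 0 j =
    derive1 (F c d j) (x 0 j) * \prod_(i < n | i != j) F c d i (x 0 i).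
  rewrite mxE pderiv_tensor => [|y]; last exact: smooth1_derivable.
  rewrite /tensor (bigD1 j)//= eqxx; congr (_ * _).
  by apply: eq_bigr => i /negbTE ->.
split.
- exact: smooth_tensor.
- by move=> x; apply: prodr_ge0 => i _; case/andP: (hH (d^-1 * x 0 i + - (d^-1 * c 0 i))).
- move=> x xc; apply: (big_ind (fun y => 1 <= y)) => // [a b|i _]; first exact: mulr_ege1.
  apply: h1.
  by rewrite argE mulrC ler_pdivrMr// mul1r.
- move=> x /existsNP[i /negP]; rewrite -ltNge => xi.
  have arg2 : 2 < `|d^-1 * x 0 i + - (d^-1 * c 0 i)|.
    by rewrite argE mulrC ltr_pdivlMr.
  have F0 : F c d i (x 0 i) = 0 by apply: (h2 _).1; exact: ltW.
  split; first by rewrite /tensor (bigD1 i)//= F0 mul0r.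
  apply/rowP => j; rewrite gradE [RHS]mxE; have [->|ij] := eqVneq j i.
    by rewrite dF (h2 _).2// mulr0 mul0r.
  by rewrite (bigD1 i) 1?eq_sym//= F0 mul0r mulr0.
- move=> x; rewrite (@le_trans _ _ (n%:R * (H ^+ n / d)))//; last first.
    by rewrite mulrA ler_wpM2r ?lerDl// ltW.
  apply: enorm_le_coord => j; rewrite gradE normrM dF normrM [X in X * _ * _]gtr0_norm//.
  have P : `|\prod_(i < n | i != j) F c d i (x 0 i)| * H <= H ^+ n.
    rewrite normr_prod -[X in H ^+ X]card_ord -prodr_const.
    rewrite [leRHS](bigD1 j)//= mulrC ler_wpM2l ?(ltW H_gt0)//.
    apply: ler_prod => i _; rewrite normr_ge0/=.
    case/andP: (hH (d^-1 * x 0 i + - (d^-1 * c 0 i))) => a b.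
    by rewrite ger0_norm// (le_trans b)// lerDl.
  rewrite -mulrA mulrC ler_pM2r// (le_trans _ P)// mulrC ler_wpM2l//.
  by rewrite (le_trans (h'H _))// lerDl.
Qed.

(** * Integrals bounded by sums of indicators *)

(** The integral of a nonnegative function is a supremum over the simple
functions below it, so comparison does not depend on measurability. *)
Lemma ge0_le_integral_nomeas d (T : measurableType d) (R : realType)
    (mu : {measure set T -> \bar R}) (D : set T) (f g : T -> \bar R) :
  (forall x, D x -> 0 <= f x)%E -> (forall x, D x -> f x <= g x)%E ->
  (\int[mu]_(x in D) f x <= \int[mu]_(x in D) g x)%E.
Proof.
move=> f0 fg; have g0 x : D x -> (0 <= g x)%E by move=> Dx; rewrite (le_trans (f0 _ Dx))// fg.
rewrite !ge0_integralE//; apply: ge_ereal_sup => _ [h hf <-].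
apply: ereal_sup_ubound; exists h => // x; rewrite (le_trans (hf x))//.
rewrite !patchE; case: ifPn => // /[!inE]; exact: fg.
Qed.

Section integral_of_simple_bounds.
Context d (T : measurableType d) (R : realType) (mu : {measure set T -> \bar R}).
Variables (I : Type) (s : seq I) (w : I -> R) (A : I -> set T).
Hypothesis w0 : forall i, 0 <= w i.
Hypothesis mA : forall i, measurable (A i).

Lemma integral_lincomb_indic (D : set T) : measurable D ->
  (\int[mu]_(x in D) (\sum_(i <- s) w i * \1_(A i) x)%:E =
   \sum_(i <- s) (w i)%:E * mu (A i `&` D))%E.
Proof.
move=> mD; under eq_integral do rewrite -sumEFin.
rewrite ge0_integral_sum//.
- apply: eq_bigr => i _.
  under eq_integral do rewrite EFinM.
  rewrite ge0_integralZl_EFin//; first by rewrite integral_indic.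
  by apply/measurable_EFinP; exact: measurable_indic.
- move=> i; apply/measurable_EFinP; apply: measurable_funM; first exact: measurable_cst.
  exact: measurable_indic.
- by move=> i x _; rewrite lee_fin mulr_ge0.
Qed.

Lemma integral_le_lincomb (D : set T) (f : T -> R) : measurable D ->
  (forall x, D x -> 0 <= f x) ->
  (forall x, D x -> f x <= \sum_(i <- s) w i * \1_(A i) x) ->
  (\int[mu]_(x in D) (f x)%:E <= \sum_(i <- s) (w i)%:E * mu (A i))%E.
Proof.
move=> mD f0 fle.
apply: (@le_trans _ _ (\int[mu]_(x in D) (\sum_(i <- s) w i * \1_(A i) x)%:E)%E).
  by apply: ge0_le_integral_nomeas.
rewrite integral_lincomb_indic//; apply: lee_sum => i _.
rewrite lee_wpmul2l ?lee_fin// le_measure ?inE//.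
exact: measurableI.
Qed.


(** Bounded overlap, integrated against mu. *)
Lemma overlap_measure (B : set T) (L : R) : measurable B -> 0 <= L ->
  (forall i, w i != 0 -> A i `<=` B) ->
  (forall y, B y -> \sum_(i <- s) w i * \1_(A i) y <= L) ->
  (\sum_(i <- s) (w i)%:E * mu (A i) <= L%:E * mu B)%E.
Proof.
move=> mB L0 AB hL.
rewrite (eq_bigr (fun i => (w i)%:E * mu (A i `&` B))%E) => [|i _]; last first.
  by have [->|wi] := eqVneq (w i) 0; [rewrite !mul0e|rewrite setIidl//; exact: AB].
rewrite -integral_lincomb_indic// -integral_cst//.
apply: ge0_le_integral_nomeas => y By; rewrite lee_fin; last exact: hL.
by apply: sumr_ge0 => i _; rewrite mulr_ge0.
Qed.

End integral_of_simple_bounds.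

Lemma geometric_sum_le (R : realType) (g : R) N : 0 < g < 1 ->
  \sum_(0 <= k < N) g ^+ k <= (1 - g)^-1.
Proof.
move=> /andP[g0 g1]; have g1' : 0 < 1 - g by rewrite subr_gt0.
rewrite -[leRHS]mul1r ler_pdivlMr// big_mkord.
have -> : (\sum_(i < N) g ^+ i) * (1 - g) = 1 - g ^+ N.
  by rewrite -[RHS]opprB subrX1 mulrC -mulNr opprB.
by rewrite gerBl exprn_ge0// ltW.
Qed.

Section power_of_sums.
Context {R : realType}.
Implicit Types (a b p q : R).

Lemma powR_exprn a q k : 0 <= a -> (a ^+ k) `^ q = (a `^ q) ^+ k.
Proof. by move=> a0; rewrite -powR_mulrn// powRAC powR_mulrn ?powR_ge0. Qed.

Lemma powR_addr1 a q : 0 < q -> 0 <= a -> a `^ (q + 1) = a * a `^ q.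
Proof.
by move=> q0 a0; rewrite -[q in RHS](addrK 1 q) mulr_powRB1// addr_gt0.
Qed.

(** Convexity of the power q + 1 (the graph lies above its tangent at a), here
a form of Young's inequality. *)
Lemma powR_subr_le a b q : 0 < q -> 0 <= b -> 0 <= a ->
  a `^ (q + 1) - b `^ (q + 1) <= (q + 1) * (a - b) * a `^ q.
Proof.
move=> q0 b0 a0; have p0 : 0 < q + 1 by rewrite addr_gt0.
have H : a `^ q * b <= a `^ (q + 1) / ((q + 1) / q) + b `^ (q + 1) / (q + 1).
  have {1}-> : q + 1 = q * ((q + 1) / q) by field; rewrite gt_eqF.
  rewrite powRrM; apply: conjugate_powR => //; first exact: powR_ge0.
    exact: divr_gt0.
  by field; rewrite !gt_eqF.
move: H; rewrite !powR_addr1// => H.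
have : (q + 1) * (a `^ q * b) <= q * (a * a `^ q) + b * b `^ q.
  rewrite [leRHS](_ : _ = (q + 1) * (a * a `^ q / ((q + 1) / q) + b * b `^ q / (q + 1))).
    by rewrite ler_pM2l.
  by field; rewrite !gt_eqF.
lra.
Qed.

(** Adding the terms one at a time, from the last one backwards, and using the
tangent inequality at each step. *)
Lemma powR_sum_le_tails q (b : nat -> R) N : 0 < q -> (forall k, 0 <= b k) ->
  (\sum_(0 <= k < N) b k) `^ (q + 1) <=
  (q + 1) * \sum_(0 <= k < N) b k * (\sum_(k <= j < N) b j) `^ q.
Proof.
move=> q0; elim: N b => [|N ih] b b0.
  by rewrite !big_geq// mulr0 powR0// gt_eqF// addr_gt0.
rewrite [X in _ <= _ * X]big_nat_recl// mulrDr.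
have := ih (fun k => b k.+1) (fun k => b0 k.+1).
have T0 : 0 <= \sum_(0 <= k < N) b k.+1 by apply: sumr_ge0.
have e : \sum_(0 <= k < N.+1) b k = b 0%N + \sum_(0 <= k < N) b k.+1 by rewrite big_nat_recl.
rewrite [X in _ -> _ <= _ + _ * X](eq_bigr (fun k => b k.+1 * (\sum_(k <= j < N) b j.+1) `^ q)); last first.
  by move=> k _; rewrite big_add1.
have := @powR_subr_le (\sum_(0 <= k < N.+1) b k) (\sum_(0 <= k < N) b k.+1) q q0 T0.
rewrite {1 2 3}e => /(_ (addr_ge0 (b0 _) T0)); rewrite addrK -e -mulrA => h1 h2.
by rewrite (le_trans _ (lerD h1 h2))// subrK.
Qed.

(** The weights g ^+ k have sum at most 1 / (1 - g), so some term is at least its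
weighted share of the sum. *)
Lemma powR_sum_le_geometric q (b : nat -> R) N (g : R) : 0 < q -> 0 < g < 1 ->
  (forall k, 0 <= b k) ->
  (\sum_(0 <= k < N) b k) `^ q <=
  (1 - g)^-1 `^ q * \sum_(0 <= k < N) (g ^- k) `^ q * b k `^ q.
Proof.
move=> q0 /andP[g0 g1] b0; have g1' : 0 < 1 - g by rewrite subr_gt0.
have qn0 : q != 0 by rewrite gt_eqF.
pose T := \sum_(0 <= k < N) b k.
have T0 : 0 <= T by exact: sumr_ge0.
have S0 k : 0 <= (g ^- k) `^ q * b k `^ q by rewrite mulr_ge0 ?powR_ge0.
rewrite -/T; have [->|Tn0] := eqVneq T 0.
  rewrite powR0 ?mulr_ge0 ?powR_ge0 ?sumr_ge0//.
have {}T0 : 0 < T by rewrite lt_neqAle eq_sym Tn0.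
have [j jN hj] : exists2 j, (j < N)%N & g ^+ j * (1 - g) * T <= b j.
  apply: contrapT => /forall2NP H.
  have lt_b k : (k < N)%N -> b k < g ^+ k * (1 - g) * T.
    by move=> kN; case: (H k) => [//|/negP]; rewrite ltNge.
  have [N0|N0] := posnP N; first by move: T0; rewrite /T N0 big_geq// ltxx.
  have : T < \sum_(0 <= k < N) g ^+ k * (1 - g) * T.
    by apply: ltr_sum_nat => // k /andP[_ /lt_b].
  rewrite -!mulr_suml; apply/negP; rewrite -leNgt ler_piMl ?(ltW T0)//.
  by rewrite -ler_pdivlMr// div1r geometric_sum_le// g0 g1.
apply: (@le_trans _ _ ((1 - g)^-1 `^ q * ((g ^- j) `^ q * b j `^ q))).
  rewrite -!powRM ?invr_ge0 ?exprn_ge0 ?mulr_ge0 ?invr_ge0 ?exprn_ge0 ?(ltW g1') ?(ltW g0)//.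
  rewrite ge0_ler_powR ?nnegrE ?(ltW T0) ?(ltW q0) ?mulr_ge0 ?invr_ge0 ?exprn_ge0 ?(ltW g1') ?(ltW g0)//.
  have gj : 0 < g ^+ j by rewrite exprn_gt0.
  have -> : T = (1 - g)^-1 * (g ^- j * (g ^+ j * (1 - g) * T)).
    by field; rewrite !gt_eqF// expf_eq0 gt_eqF// andbF.
  by rewrite !ler_wpM2l ?invr_ge0// ltW.
rewrite ler_wpM2l ?powR_ge0// (bigD1_seq j) ?mem_index_iota ?iota_uniq//=.
by rewrite lerDl sumr_ge0.
Qed.

(** A sum with at most L nonzero terms is at most L times the largest one. *)
Lemma powR_sum_le_card (I : finType) q (t : I -> R) (P : pred I) (L : nat) : 0 < q ->
  (forall i, 0 <= t i) -> (forall i, ~~ P i -> t i = 0) -> (#|P| <= L)%N ->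
  (\sum_i t i) `^ q <= L%:R `^ q * \sum_i t i `^ q.
Proof.
move=> q0 t0 tP PL; have qn0 : q != 0 by rewrite gt_eqF.
have -> : \sum_i t i = \sum_(i | P i) t i.
  by rewrite [LHS](bigID P)/= [X in _ + X]big1 ?addr0.
have [i0 Pi0|P0] := pickP P; last first.
  rewrite big_pred0// powR0// mulr_ge0 ?powR_ge0// sumr_ge0// => i _; exact: powR_ge0.
case: (@Order.TotalTheory.arg_maxP _ _ _ i0 P t Pi0) => i Pi hi.
apply: (@le_trans _ _ ((L%:R * t i) `^ q)).
  rewrite ge0_ler_powR ?nnegrE ?(ltW q0) ?mulr_ge0 ?sumr_ge0//.
  rewrite (@le_trans _ _ (\sum_(k | P k) t i))//; first exact: ler_sum.
  by rewrite sumr_const -[leLHS]mulr_natl ler_wpM2r// ler_nat.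
rewrite powRM// ler_wpM2l ?powR_ge0// (bigD1 i)//= lerDl sumr_ge0// => k _.
exact: powR_ge0.
Qed.

(** The pointwise form of Wolff's inequality. When b k is the size of the gradient
at scale 2^-k, the terms with k <= j pair a cell with the smaller cells inside
it. The power q on the smaller cells makes their contribution additive in the
measure, with a gain 2^-(j - k); any growth rate below 2, such as 3 / 2, is then
summable. *)
Lemma wolff_pointwise q : 1 <= q -> exists2 C : R, 0 < C & forall (b : nat -> R) N,
  (forall k, 0 <= b k) ->
  (\sum_(0 <= k < N) b k) `^ (q + 1) <=
  C * \sum_(0 <= k < N) b k * (\sum_(k <= j < N) (3 / 2) ^+ (j - k) * b j `^ q).
Proof.
move=> q1; have q0 : 0 < q by exact: lt_le_trans q1.
pose g : R := (2 / 3) `^ q^-1.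
have g0 : 0 < g by apply: powR_gt0; lra.
have g1 : g < 1.
  suff : g < 1 `^ q^-1 by rewrite powR1.
  rewrite /g gt0_ltr_powR ?invr_gt0 ?nnegrE//; lra.
have gq k : (g ^- k) `^ q = (3 / 2) ^+ k.
  rewrite -exprVn powR_exprn ?invr_ge0 ?(ltW g0)// /g -powRN -powRrM.
  by rewrite mulNr mulVf ?gt_eqF// powR_inv1 ?invf_div// divr_ge0.
exists ((q + 1) * (1 - g)^-1 `^ q).
  by apply: mulr_gt0; [rewrite addr_gt0|apply: powR_gt0; rewrite invr_gt0 subr_gt0].
move=> b N b0; apply: le_trans (powR_sum_le_tails N q0 b0) _.
rewrite -mulrA ler_wpM2l ?addr_ge0 ?(ltW q0)// mulr_sumr.
apply: ler_sum => k _; rewrite mulrCA ler_wpM2l//.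
rewrite -{1 2}(add0n k) !big_addn.
apply: le_trans (@powR_sum_le_geometric q (fun i => b (i + k)%N) (N - k) g q0 _ _) _ => //.
  by rewrite g0 g1.
by under [X in _ <= _ * X]eq_bigr do rewrite addnK; under [X in _ * X <= _]eq_bigr do rewrite gq.
Qed.

End power_of_sums.

(** * Lattice points and the Wolff density *)
Section lattice.
Context {R : realType} {n : nat}.
Variables (x0 : 'rV[R]_n) (d : R) (K : nat).
Hypothesis d0 : 0 < d.

Definition lattice_pt (z : {ffun 'I_n -> 'I_(K.*2.+1)}) : 'rV[R]_n :=
  \row_i (x0 0 i + d * ((z i)%:R - K%:R)).

Lemma lattice_cover (x : 'rV[R]_n) : (forall i, `|x 0 i - x0 0 i| <= d * K%:R) ->
  exists z, cube (lattice_pt z) d x.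
Proof.
move=> hx; pose t i : R := (x 0 i - x0 0 i) / d + K%:R.
have ht i : 0 <= t i <= (K.*2)%:R.
  have := hx i; rewrite ler_norml => /andP[a b].
  have ha : - K%:R <= (x 0 i - x0 0 i) / d by rewrite ler_pdivlMr// mulNr mulrC.
  have hb : (x 0 i - x0 0 i) / d <= K%:R by rewrite ler_pdivrMr// mulrC.
  rewrite /t -muln2 natrM; apply/andP; split; lra.
have tK i : (Num.truncn (t i) < K.*2.+1)%N.
  have /andP[t0 t1] := ht i.
  rewrite ltnS -(ler_nat R) (le_trans _ t1)//.
  by have /andP[] := truncn_itv t0.
exists [ffun i => Ordinal (tK i)] => i; rewrite mxE ffunE/=.
have /andP[t0 _] := ht i; have /andP[] := truncn_itv t0.
rewrite -natr1 => a b.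
have -> : x 0 i = x0 0 i + d * (t i - K%:R) by rewrite /t; field; rewrite gt_eqF.
rewrite (_ : _ - _ = d * (t i - (Num.truncn (t i))%:R)); last by ring.
rewrite normrM gtr0_norm// ger0_norm ?subr_ge0// -[leRHS]mulr1 ler_pM2l//.
by rewrite lerBlDl ltW.
Qed.

(** Two lattice points close to y whose coordinates agree modulo 2 D + 1 are equal,
so reduction modulo 2 D + 1 is injective on the points counted here. *)
Lemma lattice_overlap (D : nat) (y : 'rV[R]_n) :
  (#|[pred z | `[< cube (lattice_pt z) (d * D%:R) y >]]| <= D.*2.+1 ^ n)%N.
Proof.
pose f (z : {ffun 'I_n -> 'I_(K.*2.+1)}) : {ffun 'I_n -> 'I_(D.*2.+1)} :=
  [ffun i => inord (z i %% D.*2.+1)].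
have -> : (D.*2.+1 ^ n = #|{: {ffun 'I_n -> 'I_(D.*2.+1)}}|)%N.
  by rewrite card_ffun !card_ord.
rewrite -(@card_in_image _ _ f); first exact: max_card.
move=> z z' /asboolW yz /asboolW yz' /ffunP fzz'.
apply/ffunP => i; apply/val_inj => /=.
have := fzz' i; rewrite !ffunE => /(congr1 val)/=; rewrite !inordK ?ltn_mod// => e.
have close : `|((z i)%:R - (z' i)%:R : R)| <= (D.*2)%:R.
  have := yz i; have := yz' i; rewrite !mxE => h h'.
  rewrite -(ler_pM2l d0) -[d in leLHS]gtr0_norm// -normrM.
  rewrite (_ : d * _ = (y 0 i - (x0 0 i + d * ((z' i)%:R - K%:R))) -
    (y 0 i - (x0 0 i + d * ((z i)%:R - K%:R)))); last by ring.
  have -> : (D.*2)%:R = D%:R + D%:R :> R by rewrite -natrD addnn.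
  by rewrite (le_trans (ler_normB _ _))// [leRHS]mulrDr lerD.
wlog zz' : z z' yz yz' fzz' e close / (z i <= z' i)%N.
  move=> H; have [|/ltnW] := leqP (z i) (z' i); first exact: H.
  by move=> h; apply/esym; apply: H => //; rewrite distrC.
move: close; rewrite distrC -natrB// ger0_norm// ler_nat => close.
apply/eqP; rewrite eqn_leq zz' /=.
have := esym e => /eqP; rewrite (eqn_mod_dvd _ zz') => dv.
have [e0|h] := posnP (z' i - z i)%N; first by rewrite -subn_eq0 e0.
by have := dvdn_leq h dv; rewrite leqNgt ltnS close.
Qed.

End lattice.

Section wolff_density.
Context {R : realType} {n : nat}.
Variables (mu : {finite_measure set (borelRn R n) -> \bar R}) (p q : R).
Hypothesis q_gt0 : 0 < q.
Hypothesis p_ltn : p < n%:R.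

Definition mass (A : set 'rV[R]_n) : R := fine (mu A).

Lemma mass_fin (A : set 'rV[R]_n) : measurable (A : set (borelRn R n)) ->
  mu A = (mass A)%:E.
Proof. by move=> mA; rewrite /mass fineK//; exact: fin_num_measure. Qed.

Lemma mass_ge0 A : 0 <= mass A. Proof. exact: fine_ge0. Qed.

Lemma le_mass (A B : set 'rV[R]_n) : measurable (A : set (borelRn R n)) ->
  measurable (B : set (borelRn R n)) -> A `<=` B -> mass A <= mass B.
Proof.
by move=> mA mB AB; rewrite -lee_fin -!mass_fin// le_measure ?inE.
Qed.

(** The integrand of the Wolff potential, without the factor 1 / t. *)
Definition density x (t : R) : R :=
  (mass (eball x t) / t `^ (n%:R - p)) `^ q^-1.

(** The factor lost in the density when a radius is doubled. *)
Definition kappa : R := 2 `^ ((n%:R - p) / q).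

Lemma kappa_ge1 : 1 <= kappa.
Proof.
rewrite /kappa -[leLHS](powRr0 2) ler_powR ?ler1n// divr_ge0 ?subr_ge0//; exact: ltW.
Qed.

Lemma kappa_gt0 : 0 < kappa. Proof. exact: lt_le_trans kappa_ge1. Qed.

Lemma density_ge0 x t : 0 <= density x t. Proof. exact: powR_ge0. Qed.

Lemma sub_eball (x y : 'rV[R]_n) (s t : R) : enorm (y - x) + s <= t -> eball y s `<=` eball x t.
Proof.
move=> h z /= zy; rewrite /eball/= (le_lt_trans (enorm_triangle y _ _))//.
by rewrite addrC (lt_le_trans _ h)// ltrD2l.
Qed.

Lemma density_le (y : 'rV[R]_n) (s A : R) (k : nat) : 0 < s -> mass (eball y s) <= A ->
  density y s <= kappa ^+ k * (A / (2 ^+ k * s) `^ (n%:R - p)) `^ q^-1.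
Proof.
move=> s0 mA; have A0 : 0 <= A by exact: le_trans (mass_ge0 _) mA.
have k0 : 0 < 2 ^+ k :> R by rewrite exprn_gt0.
have -> : kappa ^+ k = ((2 ^+ k) `^ (n%:R - p)) `^ q^-1.
  by rewrite /kappa -powRrM powR_exprn.
rewrite -powRM ?divr_ge0 ?powR_ge0//.
rewrite ge0_ler_powR ?invr_ge0 ?nnegrE ?(ltW q_gt0) ?mulr_ge0 ?invr_ge0 ?powR_ge0 ?mass_ge0//.
rewrite powRM ?(ltW k0) ?(ltW s0)//.
have a0 : 0 < (2 ^+ k) `^ (n%:R - p) by exact: powR_gt0.
have b0 : 0 < s `^ (n%:R - p) by exact: powR_gt0.
rewrite [leRHS](_ : _ = A / s `^ (n%:R - p)); last by field; rewrite !gt_eqF.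
by rewrite ler_wpM2r// invr_ge0 ltW.
Qed.

Lemma density_sub (x y : 'rV[R]_n) (s t : R) (k : nat) : 0 < s -> t = 2 ^+ k * s ->
  enorm (y - x) + s <= t -> density y s <= kappa ^+ k * density x t.
Proof.
move=> s0 -> h; apply: density_le => //.
by apply: le_mass; [exact: measurable_eball|exact: measurable_eball|exact: sub_eball].
Qed.

Lemma density_powq x t : density x t `^ q = mass (eball x t) / t `^ (n%:R - p).
Proof.
by rewrite /density -powRrM mulVf ?gt_eqF// powRr1// divr_ge0 ?powR_ge0 ?mass_ge0.
Qed.

End wolff_density.

(** * The test function and its energy *)

Lemma sum_shift3 (R : realType) (D : nat -> R) (c : R) N : 0 <= c -> (forall k, 0 <= D k) ->
  \sum_(0 <= k < N) (if (k < 3)%N then c else D (k - 3)%N) <=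
  3 * c + \sum_(0 <= k < N) D k.
Proof.
move=> c0 D0; pose G k := if (k < 3)%N then c else D (k - 3)%N.
have G0 k : 0 <= G k by rewrite /G; case: ifP.
apply: (@le_trans _ _ (\sum_(0 <= k < N.+3) G k)).
  by rewrite [leRHS](@big_cat_nat _ _ _ N)//= ?lerDl ?sumr_ge0//; exact/leqW/leqW/leqW.
rewrite big_nat_recl// big_nat_recl// big_nat_recl//.
have -> : \sum_(0 <= i < N) G i.+3 = \sum_(0 <= k < N) D k.
  by apply: eq_bigr => k _; rewrite /G/= !subSS subn0.
by rewrite /G/=; lra.
Qed.

Section test_function.
Context {R : realType} {n : nat}.
Variables (mu : {finite_measure set (borelRn R n) -> \bar R}) (p q : R).
Variables (x0 : 'rV[R]_n) (r lam : R).
Hypothesis n_gt0 : (0 < n)%N.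
Hypothesis q_ge1 : 1 <= q.
Hypothesis p_ltn : p < n%:R.
Hypothesis p_eq : p = q + 1.
Hypothesis r_gt0 : 0 < r.
Hypothesis lam_gt0 : 0 < lam.

Let q_gt0 : 0 < q := lt_le_trans ltr01 q_ge1.
Let kap := @kappa R n p q.
Let kap1 : 1 <= kap := kappa_ge1 q_gt0 p_ltn.
Let kap0 : 0 < kap := kappa_gt0 q_gt0 p_ltn.
Local Notation mass := (mass mu).
Local Notation dens := (density mu p q).
Let M0 := mass (eball x0 (2 * r)).

(** With lattice step len k / (8 n), a cube whose half-width is two steps has
Euclidean radius at most len k / 4, and r is a whole number of steps. Since
len 0 = r / 4, all cubes near the shell stay in the wide shell. *)
Definition len (k : nat) : R := r / 4 / 2 ^+ k.
Definition step (k : nat) : R := len k / (8 * n)%:R.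
Definition halfwidth (k : nat) : nat := (8 * n * 2 ^ k.+2)%N.
Definition partial_wolff (x : 'rV[R]_n) (k : nat) : R :=
  \sum_(0 <= j < k.+1) dens x (len j).

Let A0 := (M0 / len 0 `^ (n%:R - p)) `^ q^-1.
(** At the coarsest scale the density is small compared with lam, so that only
the fine scales can make the Wolff sum exceed lam. *)
Hypothesis top_small : A0 <= lam / (4 * kap).

Local Notation cell k := {ffun 'I_n -> 'I_((halfwidth k).*2.+1)}.
Definition node := {k : nat & cell k}.
Definition mknode k (z : cell k) : node := existT _ k z.
Definition center (i : node) : 'rV[R]_n := lattice_pt x0 (step (tag i)) (tagged i).
Definition nodes (N : nat) : seq node :=
  [seq mknode z | k <- index_iota 0 N, z <- index_enum (cell k)].

Definition shell : set 'rV[R]_n := [set x | r / 2 <= enorm (x - x0) <= r].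
Definition relevant (i : node) : Prop :=
  exists2 x, shell x & cube (center i) (step (tag i)) x.

(** The coefficients stop at the first level at which the partial Wolff sum
exceeds lam; this truncation is what keeps the energy proportional to lam. *)
Definition coef (i : node) : R :=
  if `[< relevant i >] && (partial_wolff (center i) (tag i) <= lam)
  then dens (center i) (len (tag i)) else 0.

Lemma sum_nodes N (F : node -> R) :
  \sum_(i <- nodes N) F i = \sum_(0 <= k < N) \sum_(z : cell k) F (mknode z).
Proof. by rewrite /nodes big_allpairs_dep. Qed.

Lemma len_gt0 k : 0 < len k.
Proof. by rewrite /len !divr_gt0// exprn_gt0. Qed.

Lemma len_add k j : len k = 2 ^+ j * len (k + j).
Proof. by rewrite /len exprD; field; rewrite !expf_neq0. Qed.

Lemma len_le k j : (k <= j)%N -> len j <= len k.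
Proof.
move=> kj; rewrite (len_add k (j - k)) subnKC// ler_peMl ?(ltW (len_gt0 _))//.
by rewrite exprn_ege1// ler1n.
Qed.

Lemma len_leq_r k : len k <= r / 4.
Proof. by rewrite (le_trans (len_le (leq0n k)))// /len expr0 divr1. Qed.

Let n8 : 0 < (8 * n)%:R :> R. Proof. by rewrite ltr0n muln_gt0. Qed.

Lemma step_gt0 k : 0 < step k.
Proof. by rewrite /step divr_gt0// len_gt0. Qed.

Lemma len_step k : len k = (8 * n)%:R * step k.
Proof. by rewrite /step mulrC divfK// gt_eqF. Qed.

Lemma step_halfwidth k : step k * (halfwidth k)%:R = r.
Proof.
rewrite /halfwidth natrM mulrA (mulrC (step k)) -len_step /len natrX exprSr exprS.
by field; rewrite !expf_neq0.
Qed.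

Lemma cube_enorm (c y : 'rV[R]_n) k (a : R) : cube c (a * step k) y ->
  enorm (y - c) <= a * len k / 8.
Proof.
move=> /enorm_cube /le_trans; apply; rewrite len_step natrM.
by rewrite [leRHS](_ : _ = n%:R * (a * step k))//; field.
Qed.

Lemma relevant_near i : relevant i ->
  exists2 x, shell x & enorm (x - center i) <= len (tag i) / 8.
Proof.
by move=> [x xs xc]; exists x => //; rewrite -(mul1r (len _)); apply: cube_enorm; rewrite mul1r.
Qed.

Lemma relevant_ball i (s : R) : relevant i -> s <= len (tag i) * 2 ->
  eball (center i) s `<=` eball x0 (2 * r).
Proof.
move=> /relevant_near[x /andP[_ xr] xc] hs; apply: sub_eball.
have := enorm_triangle x (center i) x0; rewrite (enormB (center i) x).
have := len_leq_r (tag i); have := len_gt0 (tag i); lra.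
Qed.

Lemma coef_ge0 i : 0 <= coef i.
Proof. by rewrite /coef; case: ifPn => // _; exact: density_ge0. Qed.

Lemma coef_neq0 i : coef i != 0 ->
  relevant i /\ partial_wolff (center i) (tag i) <= lam.
Proof. by rewrite /coef; case: ifPn => [/andP[/asboolP ? ?]|]; rewrite ?eqxx. Qed.

Lemma coef_le i : coef i <= dens (center i) (len (tag i)).
Proof. by rewrite /coef; case: ifPn => // _; exact: density_ge0. Qed.

Lemma dens_top (c : 'rV[R]_n) k : eball c (len k) `<=` eball x0 (2 * r) ->
  dens c (len k) <= kap ^+ k * (lam / (4 * kap)).
Proof.
move=> h; apply: (@le_trans _ _ (kap ^+ k * A0)).
  rewrite /A0 (len_add 0 k); apply: density_le => //; first exact: len_gt0.
  by apply: le_mass => //; exact: measurable_eball.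
by rewrite ler_wpM2l// exprn_ge0// ltW.
Qed.

(** A bound for the number of cells of one level whose centers lie within twice
the length of that level from a given point. *)
Definition mult : nat := locked ((16 * n).*2.+1 ^ n)%N.

Lemma overlap k (y : 'rV[R]_n) (P : pred (cell k)) :
  (forall z, P z -> enorm (y - center (mknode z)) <= 2 * len k) ->
  (#|P| <= mult)%N.
Proof.
rewrite /mult -lock => h; apply: leq_trans (lattice_overlap x0 (halfwidth k) (step_gt0 k) (16 * n) y).
apply/subset_leq_card/fintype.subsetP => z Pz; apply/asboolP => i.
have := h z Pz; rewrite len_step => H.
have := coord_le_enorm (y - center (mknode z)) i; rewrite !mxE => /le_trans; apply.
by rewrite (le_trans H)// mulrA -natrM mulnA mulrC.
Qed.

Lemma level_sum k (y : 'rV[R]_n) (F : cell k -> R) (b : R) : 0 <= b ->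
  (forall z, 0 <= F z) -> (forall z, F z != 0 -> enorm (y - center (mknode z)) <= 2 * len k) ->
  (forall z, F z <= b) -> \sum_z F z <= mult%:R * b.
Proof.
move=> b0 F0 hF Fb.
rewrite (bigID (fun z => F z != 0))/= [X in _ + X]big1 ?addr0; last by move=> z /negPn/eqP.
apply: (@le_trans _ _ (\sum_(z | F z != 0) b)); first exact: ler_sum.
by rewrite sumr_const -[leLHS]mulr_natl ler_wpM2r// ler_nat; exact: overlap hF.
Qed.

(** The cells charging y at all levels up to N are compared with a single cell of
the deepest level that charges y: a ball of radius len k around a cell charging
y lies in the ball of radius len (k - 3) around the center c of that deepest
cell, and the partial Wolff sum at c is at most lam by the truncation. The three
coarsest levels are controlled by the total mass instead. *)
Lemma coef_sum_le N (y : 'rV[R]_n) :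
  \sum_(i <- nodes N) coef i * \1_(eball (center i) (2 * len (tag i))) y <=
  mult%:R * (4 * kap ^+ 3 * lam).
Proof.
rewrite sum_nodes.
have rhs0 : 0 <= mult%:R * (4 * kap ^+ 3 * lam).
  by rewrite !mulr_ge0 ?exprn_ge0// ltW.
elim: N => [|N ih]; first by rewrite big_geq.
pose F k (z : cell k) : R := coef (mknode z) * \1_(eball (center (mknode z)) (2 * len k)) y.
have F0 k z : 0 <= F k z by rewrite /F mulr_ge0 ?coef_ge0.
have Fne k (z : cell k) : F k z != 0 ->
    coef (mknode z) != 0 /\ enorm (y - center (mknode z)) < 2 * len k.
  rewrite /F mulf_eq0 negb_or => /andP[-> ]; rewrite indicE.
  by case: (boolP (_ \in _)) => [|_]; [rewrite inE|rewrite eqxx].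
(* Either level N does not charge y, or it contains the deepest cell. *)
have [[zs Fzs]|noz] := pselect (exists z : cell N, F N z != 0); last first.
  rewrite big_nat_recr//= [X in _ + X]big1 ?addr0// => z _.
  by apply/eqP/negPn/negP => h; apply: noz; exists z.
have [/coef_neq0[rs ws] ys] := Fne _ _ Fzs; set c := center _ in ys ws.
pose b k : R := kap ^+ 3 * (if (k < 3)%N then lam else dens c (len (k - 3))).
have b0 k : 0 <= b k.
  by rewrite mulr_ge0 ?exprn_ge0 ?(ltW kap0)//; case: ifP => _; [exact: ltW|exact: density_ge0].
have Fb k (z : cell k) : (k <= N)%N -> F k z <= b k.
  move=> kN; have [->//|Fk] := eqVneq (F k z) 0.
  have [/coef_neq0[rz _] yz] := Fne _ _ Fk.
  apply: (@le_trans _ _ (dens (center (mknode z)) (len k))).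
    rewrite /F indicE mem_set ?mulr1//; exact: coef_le.
  rewrite /b; case: ltnP => k3.
    apply: (le_trans (dens_top _)).
      apply: relevant_ball => //=; have := len_gt0 k; lra.
    rewrite (@le_trans _ _ (kap ^+ 3 * (lam / (4 * kap))))//.
      rewrite ler_wpM2r ?divr_ge0 ?mulr_ge0 ?(ltW kap0) ?(ltW lam_gt0)//.
      by rewrite ler_weXn2l// ltnW.
    rewrite ler_wpM2l ?exprn_ge0 ?(ltW kap0)// ler_pdivrMr ?mulr_gt0// ler_peMr ?(ltW lam_gt0)//.
    by have := kap1; lra.
  apply: density_sub; [exact: q_gt0|exact: len_gt0|by rewrite (len_add (k - 3) 3) subnK|].
  rewrite (len_add (k - 3) 3) subnK//.
  have h1 := enorm_triangle y (center (mknode z)) c.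
  have h2 := len_le kN; have h3 := len_gt0 k.
  rewrite (enormB (center (mknode z)) y) in h1.
  move: ys yz h1 h2 h3; rewrite -/c /=; lra.
apply: (@le_trans _ _ (\sum_(0 <= k < N.+1) mult%:R * b k)).
  apply: ler_sum_nat => k /andP[_ kN].
  apply: (@level_sum k y (F k)) => // [z /Fne[_ /ltW]//|z]; exact: Fb.
rewrite -mulr_sumr ler_wpM2l// /b -mulr_sumr.
rewrite [leRHS](_ : _ = kap ^+ 3 * (4 * lam)); last by ring.
rewrite ler_wpM2l ?exprn_ge0 ?(ltW kap0)//.
apply: le_trans (sum_shift3 N.+1 (ltW lam_gt0) (fun k => density_ge0 mu p q c (len k))) _.
have : \sum_(0 <= k < N.+1) dens c (len k) <= lam by exact: ws.
lra.
Qed.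

Lemma coef_mass_le N :
  \sum_(i <- nodes N) coef i * mass (eball (center i) (2 * len (tag i))) <=
  mult%:R * (4 * kap ^+ 3 * lam) * M0.
Proof.
rewrite -lee_fin EFinM -(mass_fin mu (measurable_eball x0 (2 * r))) -sumEFin.
rewrite (eq_bigr (fun i => (coef i)%:E * mu (eball (center i) (2 * len (tag i))))%E); last first.
  by move=> i _; rewrite mass_fin//; exact: measurable_eball.
apply: overlap_measure.
- exact: coef_ge0.
- by move=> i; exact: measurable_eball.
- exact: measurable_eball.
- by rewrite !mulr_ge0 ?exprn_ge0// ltW.
- by move=> i /coef_neq0[ri _]; apply: relevant_ball => //; rewrite mulrC.
- by move=> y _; exact: coef_sum_le.
Qed.

Lemma partial_wolff_recl x k :
  partial_wolff x k.+1 = dens x (len 0) + \sum_(0 <= j < k.+1) dens x (len j.+1).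
Proof. by rewrite /partial_wolff big_nat_recl. Qed.

Lemma dens_shift (x c : 'rV[R]_n) k : enorm (x - c) <= len k / 8 ->
  dens x (len k.+1) <= kap * dens c (len k).
Proof.
move=> xc; rewrite -{1}(expr1 kap); apply: density_sub => //; first exact: len_gt0.
  by rewrite (len_add k 1) addn1.
have := len_add k 1; rewrite addn1 expr1; have := len_gt0 k; lra.
Qed.

(** Below the first level at which the Wolff sum at x exceeds lam / (2 kap), no
coefficient of a cell near x is truncated, since nearby centers have comparable
Wolff sums up to a shift by one level and a factor kap. *)
Lemma coef_sum_ge (x : 'rV[R]_n) K : shell x -> lam / (2 * kap) < partial_wolff x K ->
  lam / (4 * kap ^+ 2) <= \sum_(i <- nodes K) coef i * \1_(cube (center i) (step (tag i))) x.
Proof.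
move=> xs.
have ballx k : eball x (len k) `<=` eball x0 (2 * r).
  apply: sub_eball; have /andP[_ xr] := xs; have h1 := len_leq_r k; have h2 := r_gt0.
  lra.
have kap_le (a : R) : 0 <= a -> a / kap <= a by move=> a0; rewrite ler_pdivrMr ?ler_peMr.
have q4 : lam / (4 * kap) = lam / kap / 4 by field; rewrite gt_eqF.
have q2 : lam / (2 * kap) = lam / kap / 2 by field; rewrite gt_eqF.
have lk0 : 0 < lam / kap by rewrite divr_gt0.
have lk1 : lam / kap <= lam by apply: kap_le; exact: ltW.
have top0 (c : 'rV[R]_n) : eball c (len 0) `<=` eball x0 (2 * r) -> dens c (len 0) <= lam / kap / 4.
  by move=> /dens_top; rewrite expr0 mul1r q4.
elim: K => [|K ih].
  rewrite /partial_wolff big_nat1 q2 => h; have h2 := top0 _ (ballx 0%N). lra.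
have [lt_K _|le_K hK] := ltP (lam / (2 * kap)) (partial_wolff x K).
  apply: le_trans (ih lt_K) _.
  rewrite !sum_nodes big_nat_recr//= lerDl sumr_ge0// => z _.
  by rewrite mulr_ge0// coef_ge0.
have wc (c : 'rV[R]_n) k : (k < K.+1)%N -> enorm (x - c) <= len k / 8 -> partial_wolff c k <= lam.
  move=> kK xc.
  have tc : dens c (len 0) <= lam / kap / 4.
    apply: top0; apply: sub_eball; have h1 := enorm_triangle x c x0; rewrite (enormB c x) in h1.
    have /andP[_ xr] := xs; have h2 := len_le (leq0n k).
    have h3 := len_leq_r 0; have hr := r_gt0; lra.
  case: k kK xc => [|k] kK xc; first by rewrite /partial_wolff big_nat1; lra.
  rewrite partial_wolff_recl.
  suff : \sum_(0 <= j < k.+1) dens c (len j.+1) <= kap * (lam / (2 * kap)).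
    have -> : kap * (lam / (2 * kap)) = lam / 2 by field; rewrite gt_eqF.
    lra.
  apply: (@le_trans _ _ (\sum_(0 <= j < k.+1) kap * dens x (len j))).
    rewrite big_nat [leRHS]big_nat; apply: ler_sum => j /andP[_ jk].
    apply: dens_shift; rewrite enormB (le_trans xc)// ler_wpM2r ?invr_ge0//.
    by apply: len_le; exact: ltnW.
  rewrite -mulr_sumr ler_wpM2l ?(ltW kap0)// (le_trans _ le_K)// /partial_wolff.
  rewrite [leRHS](@big_cat_nat _ _ _ k.+1)//= ?lerDl; last exact: ltnW.
  by apply: sumr_ge0 => j _; exact: density_ge0.
have near_cell k : exists z : cell k, cube (center (mknode z)) (step k) x.
  have [||z hz] := @lattice_cover R n x0 (step k) (halfwidth k) _ x.
  - exact: step_gt0.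
  - move=> i; rewrite step_halfwidth; have /andP[_] := xs; apply: le_trans.
    by have := coord_le_enorm (x - x0) i; rewrite !mxE.
  - by exists z.
have term k : (k < K.+1)%N -> dens x (len k.+1) / kap <=
    \sum_(z : cell k) coef (mknode z) * \1_(cube (center (mknode z)) (step k)) x.
  move=> kK; have [z hz] := near_cell k.
  have rel : relevant (mknode z) by exists x.
  set c := center (mknode z) in hz *.
  have xc : enorm (x - c) <= len k / 8.
    by rewrite -(mul1r (len _)); apply: cube_enorm; rewrite mul1r.
  rewrite (bigD1 z)//= ler_wpDr//.
    by apply: sumr_ge0 => z' _; rewrite mulr_ge0// coef_ge0.
  rewrite indicE mem_set// mulr1 /coef (wc c)// andbT asboolT//= ler_pdivrMr// mulrC.
  exact: dens_shift.
rewrite sum_nodes (@le_trans _ _ (\sum_(0 <= k < K.+1) dens x (len k.+1) / kap))//; last first.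
  by rewrite big_nat [leRHS]big_nat; apply: ler_sum => k /andP[_ kK]; exact: term.
rewrite -mulr_suml (ler_pdivlMr _ _ kap0).
have -> : lam / (4 * kap ^+ 2) * kap = lam / kap / 4 by field; rewrite gt_eqF.
move: hK; rewrite partial_wolff_recl q2; have := top0 _ (ballx 0%N); lra.
Qed.

Variables (H : R) (phi : 'rV[R]_n -> R -> 'rV[R]_n -> R).
Hypothesis H_gt0 : 0 < H.
Hypothesis phi_bump : forall c d, 0 < d ->
  [/\ smooth (phi c d), forall x, 0 <= phi c d x,
      forall x, cube c d x -> 1 <= phi c d x,
      forall x, ~ cube c (2 * d) x -> phi c d x = 0 /\ grad (phi c d) x = 0 &
      forall x, enorm (grad (phi c d) x) <= H / d].
Variable CW : R.
Hypothesis CW_gt0 : 0 < CW.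
Hypothesis wolff_ineq : forall (b : nat -> R) N, (forall k, 0 <= b k) ->
  (\sum_(0 <= k < N) b k) `^ (q + 1) <=
  CW * \sum_(0 <= k < N) b k * (\sum_(k <= j < N) (3 / 2) ^+ (j - k) * b j `^ q).

Definition test_sum (N : nat) (x : 'rV[R]_n) : R :=
  \sum_(i <- nodes N) coef i * phi (center i) (step (tag i)) x.

Let bump_smooth i : smooth (phi (center i) (step (tag i))).
Proof. by have [] := phi_bump (center i) (step_gt0 (tag i)). Qed.

Let bump_ge0 i x : 0 <= phi (center i) (step (tag i)) x.
Proof. by have [_ h _ _ _] := phi_bump (center i) (step_gt0 (tag i)). Qed.

Let bump_indic i x : \1_(cube (center i) (step (tag i))) x <= phi (center i) (step (tag i)) x.
Proof.
rewrite indicE; case: (boolP (_ \in _)) => [|_]; last exact: bump_ge0.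
by rewrite inE; have [_ _ h _ _] := phi_bump (center i) (step_gt0 (tag i)); exact: h.
Qed.

Lemma test_sum_smooth N : smooth (test_sum N).
Proof. by apply: smooth_lincomb => i; exact: bump_smooth. Qed.

Lemma test_sum_le N x : test_sum N x <= test_sum N.+1 x.
Proof.
rewrite /test_sum !sum_nodes big_nat_recr//= lerDl sumr_ge0// => z _.
by rewrite mulr_ge0 ?coef_ge0 ?bump_ge0//; exact: bump_ge0.
Qed.

Definition tile (i : node) : set 'rV[R]_n := cube (center i) (2 * step (tag i)).

Lemma tile_enorm i y : tile i y -> enorm (y - center i) <= len (tag i) / 4.
Proof. by move=> /cube_enorm h; rewrite (le_trans h)//; have := len_gt0 (tag i); lra. Qed.

Lemma measurable_tile i : measurable (tile i : set (borelRn R n)).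
Proof. exact: measurable_cube. Qed.

Lemma tile_relevant i : relevant i ->
  tile i `<=` [set y | r / 4 < enorm (y - x0) < 2 * r].
Proof.
move=> /relevant_near[x /andP[xl xr] xc] y /tile_enorm yc /=.
have h1 := enorm_triangle y x x0; have h2 := enorm_triangle x y x0.
have h3 := enorm_triangle (center i) y x.
rewrite (enormB x y) in h1; rewrite (enormB (center i) x) in h3.
have h4 := len_leq_r (tag i); have h5 := len_gt0 (tag i); have h6 := r_gt0.
apply/andP; split; lra.
Qed.

Lemma test_sum_test_fun N :
  test_fun [set y | r / 4 < enorm (y - x0) < 2 * r] (test_sum N).
Proof.
pose A := \big[setU/set0]_(i <- [seq i <- nodes N | coef i != 0]) tile i.
have sA : [set x | test_sum N x != 0] `<=` A.
  move=> x /= h; apply: contrapT => xA; move/eqP: h; apply.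
  rewrite /test_sum big_seq big1// => i iN.
  have [->|ci] := eqVneq (coef i) 0; first by rewrite mul0r.
  have [_ _ _ h _] := phi_bump (center i) (step_gt0 (tag i)).
  have [|-> _] := h x; last by rewrite mulr0.
  move=> xi; apply: xA; rewrite /A -bigcup_seq; exists i => //=.
  by rewrite mem_filter ci.
have cA : compact A.
  rewrite /A; elim: [seq i <- nodes N | _] => [|i s ih]; first by rewrite big_nil; exact: compact0.
  by rewrite big_cons; apply: compactU => //; exact: compact_cube.
have clA : closed A by rewrite /A; apply: closed_bigsetU => i _; exact: closed_cube.
have sub : supp (test_sum N) `<=` A.
  by rewrite /supp; move/closure_id: clA => ->; exact: closure_subset.
split.
- exact: test_sum_smooth.
- by apply: subclosed_compact cA sub; exact: closed_closure.
- move=> x /sub; rewrite /A -bigcup_seq => -[i /=]; rewrite mem_filter => /andP[ci _].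
  by apply: tile_relevant; have [] := coef_neq0 ci.
Qed.

Lemma test_sum_large (x : 'rV[R]_n) K : shell x -> lam / (2 * kap) < partial_wolff x K ->
  lam / (4 * kap ^+ 2) <= test_sum K x.
Proof.
move=> xs xK; rewrite (le_trans (coef_sum_ge xs xK))// /test_sum.
by apply: ler_sum => i _; rewrite ler_wpM2l ?coef_ge0.
Qed.

(** The size of the gradient of the part of the test function at level k, up to
the constant H. *)
Definition slope k (x : 'rV[R]_n) : R :=
  \sum_(z : cell k) coef (mknode z) / step k * \1_(tile (mknode z)) x.

Lemma slope_ge0 k x : 0 <= slope k x.
Proof.
by apply: sumr_ge0 => z _; rewrite mulr_ge0// divr_ge0 ?coef_ge0// ltW// step_gt0.
Qed.

Lemma grad_test_sum N x : enorm (grad (test_sum N) x) <= H * \sum_(0 <= k < N) slope k x.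
Proof.
rewrite grad_lincomb; last by move=> i; exact: bump_smooth.
rewrite (le_trans (enorm_sum _ _ _))// mulr_sumr sum_nodes.
apply: ler_sum => k _; rewrite mulr_sumr; apply: ler_sum => z _.
rewrite enormZ ger0_norm ?coef_ge0// -!mulrA mulrCA ler_wpM2l ?coef_ge0//.
have [_ _ _ h h'] := phi_bump (center (mknode z)) (step_gt0 k).
rewrite indicE; case: (boolP (_ \in _)) => [_|].
  by rewrite mulr1; exact: h'.
by rewrite notin_setE => /h[_ ->]; rewrite enorm0 !mulr0.
Qed.

Lemma slope_powq k x : slope k x `^ q <=
  mult%:R `^ q * \sum_(z : cell k) (coef (mknode z) / step k) `^ q * \1_(tile (mknode z)) x.
Proof.
pose t (z : cell k) : R := coef (mknode z) / step k * \1_(tile (mknode z)) x.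
have -> : \sum_(z : cell k) (coef (mknode z) / step k) `^ q * \1_(tile (mknode z)) x =
    \sum_(z : cell k) t z `^ q.
  apply: eq_bigr => z _; rewrite /t indicE; case: (_ \in _); rewrite ?mulr1// !mulr0.
  by rewrite powR0// gt_eqF.
apply: (@powR_sum_le_card _ _ _ _ [pred z : cell k | `[< tile (mknode z) x >]]) => //.
- by move=> z; rewrite mulr_ge0// divr_ge0 ?coef_ge0// ltW// step_gt0.
- by move=> z /asboolPn nz; rewrite indicE memNset// mulr0.
- apply: (@overlap k x) => z /asboolW/tile_enorm /= h; apply: (le_trans h).
  by have := len_gt0 k; lra.
Qed.

(** Expanding the right-hand side of the pointwise Wolff inequality gives one term
for each pair of a cell and a cell of a finer or equal level. *)
Definition pair_weight (ij : node * node) : R :=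
  if (tag ij.1 <= tag ij.2)%N then
    coef ij.1 / step (tag ij.1) *
    ((3 / 2) ^+ (tag ij.2 - tag ij.1) * (coef ij.2 / step (tag ij.2)) `^ q)
  else 0.

Definition pairs N := [seq (i, j) | i <- nodes N, j <- nodes N].

Lemma pair_weight_ge0 ij : 0 <= pair_weight ij.
Proof.
rewrite /pair_weight; case: ifP => // _.
have s0 i : 0 <= coef i / step (tag i) by rewrite divr_ge0 ?coef_ge0// ltW// step_gt0.
rewrite mulr_ge0 ?s0// mulr_ge0 ?powR_ge0//; apply: exprn_ge0; lra.
Qed.

Lemma grad_power N x : enorm (grad (test_sum N) x) `^ (q + 1) <=
  H `^ (q + 1) * CW * mult%:R `^ q *
  \sum_(ij <- pairs N) pair_weight ij * \1_(tile ij.1 `&` tile ij.2) x.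
Proof.
have p0 : 0 < q + 1 by rewrite addr_gt0.
have S0 : 0 <= \sum_(0 <= k < N) slope k x by apply: sumr_ge0 => k _; exact: slope_ge0.
apply: (@le_trans _ _ ((H * \sum_(0 <= k < N) slope k x) `^ (q + 1))).
  rewrite ge0_ler_powR ?nnegrE ?(ltW p0) ?enorm_ge0 ?mulr_ge0 ?(ltW H_gt0)//.
  exact: grad_test_sum.
rewrite powRM ?(ltW H_gt0)// -!mulrA ler_wpM2l ?powR_ge0//.
rewrite (le_trans (wolff_ineq _ _))//; first by move=> k; exact: slope_ge0.
rewrite ler_wpM2l ?(ltW CW_gt0)// /pairs big_allpairs_dep/= sum_nodes mulr_sumr.
apply: ler_sum_nat => k /andP[_ kN].
rewrite /slope mulr_suml mulr_sumr; apply: ler_sum => z _.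
rewrite sum_nodes [X in _ <= _ * X](@big_cat_nat _ _ _ k)//=; last exact: ltnW.
rewrite [X in _ * (X + _)]big_nat [X in _ * (X + _)]big1 ?add0r; last first.
  move=> j /andP[_ jk]; apply: big1 => z' _.
  by rewrite /pair_weight/= leqNgt jk/= mul0r.
rewrite !mulr_sumr; apply: ler_sum_nat => j /andP[kj _].
have s0 i : 0 <= coef i / step (tag i) by rewrite divr_ge0 ?coef_ge0// ltW// step_gt0.
set a := coef (mknode z) / step k * _.
have a0 : 0 <= a by rewrite mulr_ge0//; exact: (s0 (mknode z)).
apply: (@le_trans _ _ (a * ((3 / 2) ^+ (j - k) * (mult%:R `^ q * \sum_(z : cell j)
    (coef (mknode z) / step j) `^ q * \1_(tile (mknode z)) x)))).
  by rewrite ler_wpM2l// ler_wpM2l ?exprn_ge0//; exact: slope_powq.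
rewrite !mulr_sumr; apply: ler_sum => z' _.
rewrite /pair_weight/= kj indicI/= /a /=.
rewrite [leRHS](_ : _ = coef (mknode z) / step k * \1_(tile (mknode z)) x *
 ((3 / 2) ^+ (j - k) * (mult%:R `^ q * ((coef (mknode z') / step j) `^ q * \1_(tile (mknode z')) x)))) //.
by rewrite /=; ring.
Qed.

Let leb : {sigma_finite_measure set (borelRn R n) -> \bar R} := lebesgue_Rn n.

Definition meet_volume (i j : node) : R := fine (leb (tile i `&` tile j)).

Lemma measurable_meet (i j : node) : measurable (tile i `&` tile j : set (borelRn R n)).
Proof. by apply: measurableI; exact: measurable_tile. Qed.

Lemma lebesgue_tile i : leb (tile i) = ((2 * (2 * step (tag i))) ^+ n)%:E.
Proof. by apply: lebesgue_cube; rewrite mulr_ge0// ltW// step_gt0. Qed.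

Lemma le_meet_tile i j : (leb (tile i `&` tile j) <= leb (tile j))%E.
Proof.
by apply: le_measure; rewrite ?inE//; [exact: measurable_meet|exact: measurable_tile].
Qed.

Lemma meet_volumeE i j : leb (tile i `&` tile j) = (meet_volume i j)%:E.
Proof.
rewrite /meet_volume fineK// ge0_fin_numE// (le_lt_trans (le_meet_tile i j))//.
by rewrite lebesgue_tile ltry.
Qed.

Lemma meet_volume_le i j : meet_volume i j <= (4 * step (tag j)) ^+ n.
Proof.
rewrite -lee_fin -meet_volumeE (le_trans (le_meet_tile i j))// lebesgue_tile.
by rewrite mulrA (_ : 2 * 2 = 4 :> R)//; ring.
Qed.

Lemma meet_volume0 i j : tile i `&` tile j = set0 -> meet_volume i j = 0.
Proof. by rewrite /meet_volume => ->; rewrite measure0. Qed.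

(** The exponents balance: the density to the power q is mass over len ^ (n - p),
and dividing by step ^ q and multiplying by a volume of order len ^ n leaves
mass times len, because p = q + 1. *)
Lemma cell_energy i j :
  (coef j / step (tag j)) `^ q * meet_volume i j <=
  (8 * n)%:R `^ q * len (tag j) * mass (eball (center j) (len (tag j))).
Proof.
set s := step (tag j); set L := len (tag j); set m := mass _.
have s0 : 0 < s by exact: step_gt0.
have L0 : 0 < L by exact: len_gt0.
have m0 : 0 <= m by exact: mass_ge0.
have Ls : L = (8 * n)%:R * s by exact: len_step.
have e1 : (coef j / s) `^ q <= m / L `^ (n%:R - p) * ((8 * n)%:R `^ q / L `^ q).
  have -> : (8 * n)%:R `^ q / L `^ q = s^-1 `^ q.
    have es : s^-1 `^ q * s `^ q = 1.
      by rewrite -powRM ?invr_ge0 ?(ltW s0)// mulVf ?gt_eqF// powR1.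
    apply: (@mulIf _ (s `^ q)); first by rewrite gt_eqF// powR_gt0.
    rewrite es Ls powRM ?(ltW s0) ?(ltW n8)//.
    by field; rewrite !gt_eqF ?powR_gt0.
  rewrite -(density_powq mu p q_gt0) -powRM ?density_ge0 ?invr_ge0 ?(ltW s0)//.
  rewrite ge0_ler_powR ?nnegrE ?(ltW q_gt0) ?mulr_ge0 ?coef_ge0 ?density_ge0 ?invr_ge0 ?(ltW s0)//.
  by rewrite ler_wpM2r ?invr_ge0 ?(ltW s0)//; exact: coef_le.
have e2 : meet_volume i j <= L ^+ n.
  apply: le_trans (meet_volume_le i j) _; rewrite -/s.
  suff sL : 4 * s <= L.
    by apply: lerXn2r sL; rewrite nnegrE; [apply: mulr_ge0 => //; exact: ltW|exact: ltW].
  rewrite Ls ler_wpM2r ?(ltW s0)// ler_nat; apply: (@leq_trans 8) => //.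
  by rewrite leq_pmulr.
have v0 : 0 <= meet_volume i j by exact: fine_ge0.
apply: (@le_trans _ _ (m / L `^ (n%:R - p) * ((8 * n)%:R `^ q / L `^ q) * L ^+ n)).
  by apply: ler_pM => //; exact: powR_ge0.
have -> : L ^+ n = L `^ (n%:R - p) * L `^ q * L.
  rewrite -powR_mulrn ?(ltW L0)// -[X in _ = _ * X](powRr1 (ltW L0)).
  rewrite -!powRD ?(gt_eqF L0) ?implybT//.
  by congr (_ `^ _); rewrite p_eq; ring.
rewrite le_eqVlt; apply/orP; left; apply/eqP.
by field; rewrite !gt_eqF ?powR_gt0.
Qed.

(** The balls of the finer cells meeting tile i lie in a ball around center i and
overlap boundedly, so their masses add up to the mass of that ball. *)
Lemma level_energy i j : (tag i <= j)%N ->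
  \sum_(z : cell j) (coef (mknode z) / step j) `^ q * meet_volume i (mknode z) <=
  (8 * n)%:R `^ q * len j * (mult%:R * mass (eball (center i) (2 * len (tag i)))).
Proof.
move=> ij.
pose w (z : cell j) : R := if `[< tile i `&` tile (mknode z) = set0 >] then 0 else 1.
have w0 z : 0 <= w z by rewrite /w; case: ifP.
have wE z : w z != 0 -> enorm (center (mknode z) - center i) <= len (tag i) / 4 + len j / 4.
  rewrite /w; case: ifPn; rewrite ?eqxx// => /asboolPn/eqP/set0P[y [yi yz]] _.
  rewrite (le_trans (enorm_triangle y _ _))// addrC lerD//; first exact: tile_enorm.
  by rewrite enormB; exact: (tile_enorm yz).
apply: (@le_trans _ _ (\sum_(z : cell j) (8 * n)%:R `^ q * len j *
    (w z * mass (eball (center (mknode z)) (len j))))).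
  apply: ler_sum => z _; rewrite /w; case: ifPn => [/asboolP e|_].
    by rewrite meet_volume0// mulr0 mul0r mulr0.
  by rewrite mul1r; exact: (cell_energy i (mknode z)).
rewrite -mulr_sumr ler_wpM2l//.
  by rewrite mulr_ge0 ?powR_ge0// ltW// len_gt0.
rewrite -lee_fin EFinM -(mass_fin mu (measurable_eball (center i) (2 * len (tag i)))) -sumEFin.
rewrite (eq_bigr (fun z => (w z)%:E * mu (eball (center (mknode z)) (len j)))%E); last first.
  by move=> z _; rewrite mass_fin//; exact: measurable_eball.
have lij := len_le ij; have li := len_gt0 (tag i); have lj := len_gt0 j.
apply: overlap_measure => //.
- by move=> z; exact: measurable_eball.
- exact: measurable_eball.
- by move=> z /wE h; apply: sub_eball; lra.
- move=> y _; rewrite -[mult%:R]mulr1; apply: (@level_sum j y) => //.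
  + by move=> z; rewrite mulr_ge0.
  + move=> z; rewrite mulf_eq0 negb_or indicE => /andP[_].
    case: (boolP (_ \in _)) => [|_]; last by rewrite eqxx.
    by rewrite inE /eball/= => h _; lra.
  + by move=> z; rewrite /w indicE; case: ifP => _; case: (_ \in _); rewrite ?mul0r ?mul1r ?mulr1.
Qed.

Lemma geometric_len k N : \sum_(k <= j < N) (3 / 2) ^+ (j - k) * len j <= 4 * len k.
Proof.
rewrite -{1}(add0n k) big_addn.
rewrite (eq_bigr (fun i => (3 / 4) ^+ i * len k)); last first.
  move=> i _; rewrite addnK (len_add k i) (addnC i) [RHS]mulrA -exprMn; congr (_ ^+ _ * _).
  by field.
rewrite -mulr_suml ler_wpM2r ?(ltW (len_gt0 k))//.
rewrite [leRHS](_ : 4 = (1 - 3 / 4)^-1); last by field.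
by apply: geometric_sum_le; apply/andP; split; lra.
Qed.

Definition energy_const : R :=
  H `^ (q + 1) * CW * mult%:R `^ q *
  ((8 * n)%:R `^ q * mult%:R * 4 * (8 * n)%:R) * (mult%:R * (4 * kap ^+ 3)).

(** The sum over the finer levels is geometric, which leaves the sum of the
coefficients against masses estimated in coef_mass_le. *)
Lemma energy_test_sum N D : measurable (D : set (borelRn R n)) ->
  (energy p D (test_sum N) <= (energy_const * lam * M0)%:E)%E.
Proof.
move=> mD; rewrite /energy p_eq.
set C0 := H `^ (q + 1) * CW * mult%:R `^ q.
have C00 : 0 <= C0 by rewrite !mulr_ge0 ?powR_ge0// ltW.
apply: (le_trans (@integral_le_lincomb _ _ _ leb _ (pairs N) (fun ij => C0 * pair_weight ij)
  (fun ij => tile ij.1 `&` tile ij.2) _ _ D _ mD _ _)).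
- by move=> ij; rewrite mulr_ge0// pair_weight_ge0.
- by move=> ij; exact: measurable_meet.
- by move=> x _; exact: powR_ge0.
- move=> x _; rewrite (le_trans (grad_power N x))// -/C0 mulr_sumr.
  by apply: ler_sum => ij _; rewrite mulrA.
rewrite (eq_bigr (fun ij => (C0 * (pair_weight ij * meet_volume ij.1 ij.2))%:E)); last first.
  move=> ij _; transitivity ((C0 * pair_weight ij)%:E * leb (tile ij.1 `&` tile ij.2))%E => //.
  by rewrite meet_volumeE -EFinM mulrA.
rewrite sumEFin lee_fin -mulr_sumr.
pose C1 : R := (8 * n)%:R `^ q * mult%:R * 4 * (8 * n)%:R.
rewrite [leRHS](_ : _ = C0 * (C1 * (mult%:R * (4 * kap ^+ 3 * lam) * M0))); last first.
  by rewrite /energy_const -/C0 -/C1; ring.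
rewrite ler_wpM2l// /pairs big_allpairs_dep/=.
have C10 : 0 <= C1 by rewrite !mulr_ge0 ?powR_ge0.
have main i : \sum_(j <- nodes N) pair_weight (i, j) * meet_volume i j <=
    C1 * (coef i * mass (eball (center i) (2 * len (tag i)))).
  have [ciN|] := ltnP (tag i) N; last first.
    move=> Ni; rewrite sum_nodes big_nat big1.
      by rewrite !mulr_ge0 ?coef_ge0 ?mass_ge0.
    move=> j /andP[_ jN]; apply: big1 => z _.
    by rewrite /pair_weight/= leqNgt (leq_trans jN Ni)/= mul0r.
  rewrite sum_nodes (@big_cat_nat _ _ _ (tag i))//=; last exact: ltnW.
  rewrite [X in X + _]big_nat [X in X + _]big1 ?add0r; last first.
    move=> j /andP[_ ji]; apply: big1 => z _.
    by rewrite /pair_weight/= leqNgt ji/= mul0r.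
  have s0 : 0 < step (tag i) by exact: step_gt0.
  have cs0 : 0 <= coef i / step (tag i) by rewrite divr_ge0 ?coef_ge0 ?(ltW s0).
  set m := mass _.
  apply: (@le_trans _ _ (\sum_(tag i <= j < N) coef i / step (tag i) *
      (((8 * n)%:R `^ q * mult%:R * m) * ((3 / 2) ^+ (j - tag i) * len j)))).
    apply: ler_sum_nat => j /andP[ij _].
    rewrite (eq_bigr (fun z => coef i / step (tag i) * ((3 / 2) ^+ (j - tag i) *
      ((coef (mknode z) / step j) `^ q * meet_volume i (mknode z))))); last first.
      by move=> z _; rewrite /pair_weight/= ij !mulrA.
    rewrite -!mulr_sumr ler_wpM2l//.
    rewrite mulrCA ler_wpM2l ?exprn_ge0 ?divr_ge0//.
    apply: (le_trans (level_energy ij)).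
    by rewrite le_eqVlt; apply/orP; left; apply/eqP; rewrite -/m; ring.
  rewrite -!mulr_sumr.
  apply: (@le_trans _ _ (coef i / step (tag i) *
      ((8 * n)%:R `^ q * mult%:R * m * (4 * len (tag i))))).
    rewrite ler_wpM2l// ler_wpM2l ?mulr_ge0 ?powR_ge0 ?mass_ge0//.
    exact: geometric_len.
  rewrite len_step /C1 le_eqVlt; apply/orP; left; apply/eqP.
  by field; rewrite gt_eqF.
apply: (@le_trans _ _ (\sum_(i <- nodes N)
    C1 * (coef i * mass (eball (center i) (2 * len (tag i)))))).
  by apply: ler_sum => i _; exact: main.
rewrite -mulr_sumr.
by rewrite ler_wpM2l//; exact: coef_mass_le.
Qed.

End test_function.

(** * The weak type estimate for capacity *)

Lemma continuous_measurable_rV (R : realType) (n : nat) (f : 'rV[R]_n -> R) :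
  continuous f -> measurable_fun setT (f : borelRn R n -> measurableTypeR R).
Proof.
move=> cf; apply: (measurability _ (RGenOpens.measurableE R)) => //.
move=> _ [_ [a [b ->]] <-]; rewrite setTI; apply: sub_sigma_algebra.
suff : open (f @^-1` `]a, b[) by [].
by apply: open_comp; [move=> v _; exact: cf|exact: interval_open].
Qed.

Lemma measurable_grad_power (R : realType) (n : nat) (u : 'rV[R]_n -> R) (p : R) : smooth u ->
  measurable_fun setT (fun x : borelRn R n => enorm (grad u x) `^ p).
Proof.
move=> su; apply: (measurableT_comp (measurable_powR p)).
rewrite (_ : (fun _ => _) = (fun x : borelRn R n => (\sum_(i < n) pderiv i u x ^+ 2) `^ 2^-1)).
  apply: (measurableT_comp (measurable_powR 2^-1)).
  apply: measurable_sum => i; apply: measurable_funX.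
  by apply: continuous_measurable_rV; apply: smooth_continuous; exact: smooth_pderiv.
apply/funext => x; rewrite powR12_sqrt; last by apply: sumr_ge0 => i _; exact: sqr_ge0.
by rewrite /enorm; congr (Num.sqrt _); apply: eq_bigr => i _; rewrite mxE.
Qed.

Lemma gradZ (R : realType) (n : nat) (u : 'rV[R]_n -> R) (s : R) x : smooth u ->
  grad (s \*: u) x = s *: grad u x.
Proof.
by move=> su; apply/rowP => i; rewrite !mxE pderivZ// => y; exact: smooth_diff.
Qed.

Lemma energyZ (R : realType) (n : nat) (p : R) (D : set 'rV[R]_n) (u : 'rV[R]_n -> R) (s : R) :
  measurable (D : set (borelRn R n)) -> 0 <= s -> smooth u ->
  energy p D (s \*: u) = ((s `^ p)%:E * energy p D u)%E.
Proof.
move=> mD s0 su; rewrite /energy -ge0_integralZl_EFin//.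
- apply: eq_integral => x _; rewrite -EFinM gradZ// enormZ ger0_norm// powRM//.
  exact: enorm_ge0.
- by move=> x _; rewrite lee_fin powR_ge0.
- by apply/measurable_EFinP; apply: measurable_funTS; exact: measurable_grad_power.
- exact: powR_ge0.
Qed.

Lemma test_funZ (R : realType) (n : nat) (D : set 'rV[R]_n) (u : 'rV[R]_n -> R) (s : R) :
  test_fun D u -> test_fun D (s \*: u).
Proof.
move=> [su cu uD].
have sub : supp (s \*: u) `<=` supp u.
  apply: closure_subset => x /=; apply: contra => /eqP ux.
  by rewrite /GRing.scale/= ux mulr0.
split; first exact: smoothZ.
  exact: subclosed_compact (@closed_closure _ _) cu sub.
exact: subset_trans sub uD.
Qed.

Lemma compact_increasing_cover (T : ptopologicalType) (K : set T) (O : nat -> set T) :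
  compact K -> (forall N, open (O N)) -> (forall N, O N `<=` O N.+1) ->
  K `<=` \bigcup_N O N -> exists N, K `<=` O N.
Proof.
move=> cK oO mO KO; move: cK; rewrite compact_cover => cK.
have [D' _ KD'] := cK nat setT O (fun N _ => oO N) KO.
have mono i j : (i <= j)%N -> O i `<=` O j.
  move=> ij; rewrite -(subnK ij); elim: (j - i)%N => [|k ih]; first by rewrite add0n.
  by rewrite addSn; exact: subset_trans ih (mO _).
exists (\max_(i <- finmap.enum_fset D') i)%N => x /KD'[i /= iD' Oix].
by apply: mono Oix; exact: leq_bigmax_seq.
Qed.

Lemma shell_wide (R : realType) (n : nat) (x0 x : 'rV[R]_n) (r : R) : 0 < r ->
  shell x0 r x -> r / 4 < enorm (x - x0) < 2 * r.
Proof. by move=> r0 /andP[a b]; apply/andP; split; lra. Qed.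

(** The open sets where the rescaled test functions exceed 1 increase with the
number of levels and cover the set in question, so each compact subset of their
union has one of these functions as a competitor; the energies are bounded
independently of the number of levels. *)
Theorem capacity_weak_type (R : realType) (n : nat) (p q : R) :
  (0 < n)%N -> 1 <= q -> p < n%:R -> p = q + 1 -> exists2 C : R, 0 < C &
  forall (mu : {finite_measure set (borelRn R n) -> \bar R}) (x0 : 'rV[R]_n) (r lam : R),
  0 < r -> 0 < lam ->
  (mass mu (eball x0 (2 * r)) / (r / 4) `^ (n%:R - p)) `^ q^-1 <= lam / (4 * @kappa R n p q) ->
  (cap p [set x | shell x0 r x /\ exists K, (lam / (2 * @kappa R n p q) < partial_wolff mu p q r x K)%R]
     [set y | (r / 4 < enorm (y - x0) < 2 * r)%R] <=
   (C * mass mu (eball x0 (2 * r)) * lam `^ (- q))%:E)%E.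
Proof.
move=> n0 q1 pn pq.
have q0 : 0 < q by exact: lt_le_trans q1.
have [H H0 [phi hphi]] := bump_exists R n.
have [CW CW0 hCW] := @wolff_pointwise R q q1.
set kap := @kappa R n p q.
have kap0 : 0 < kap by exact: kappa_gt0.
pose C : R := (8 * kap ^+ 2) `^ p * @energy_const R n p q H CW.
have C0 : 0 <= C.
  rewrite /C /energy_const !mulr_ge0 ?powR_ge0 ?exprn_ge0 ?(ltW kap0) ?(ltW CW0)//.
exists (C + 1); first by rewrite ltr_wpDl.
move=> mu x0 r lam r0 lam0 small.
set W := [set y | r / 4 < _ < _]; set E := [set x | shell _ _ _ /\ _].
have small' : (mass mu (eball x0 (2 * r)) / (len r 0) `^ (n%:R - p)) `^ q^-1 <= lam / (4 * kap).
  by rewrite /len expr0 divr1.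
pose u N := test_sum mu p q x0 r lam phi N.
(* Twice the inverse of the lower bound of test_sum_large, to exceed 1 strictly. *)
pose s : R := 8 * kap ^+ 2 / lam.
have s0 : 0 < s by rewrite /s divr_gt0// mulr_gt0// exprn_gt0.
have su N : smooth (u N) by apply: test_sum_smooth => //; exact: hphi.
pose O N := [set x | 1 < s * u N x].
have oO N : open (O N).
  rewrite (_ : O N = (s \*: u N) @^-1` [set y | 1 < y])//.
  apply: open_comp; last exact: open_gt.
  by move=> x _; apply: smooth_continuous; exact: smoothZ.
have oW : open W.
  rewrite (_ : W = [set y | r / 4 < enorm (y - x0)] `&` [set y | enorm (y - x0) < 2 * r]).
    by apply: openI; [exact: open_enorm_gt|exact: open_enorm_lt].
  by apply/seteqP; split => [y /andP[]//|y [a b]]; apply/andP.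
have mono N : O N `<=` O N.+1.
  move=> x /= /lt_le_trans; apply; rewrite ler_wpM2l ?(ltW s0)//.
  exact: (@test_sum_le _ _ mu p q x0 r lam n0 r0 H phi hphi).
pose G := W `&` \bigcup_N O N.
have GE : [/\ open G, E `<=` G & G `<=` W].
  split; [by apply: openI => //; apply: bigcup_open => N _; exact: oO| |by move=> x []].
  move=> x [xs [K xK]]; split.
    exact: shell_wide.
  exists K => //; rewrite /O/=.
  have := test_sum_large n0 q1 pn r0 lam0 small' hphi xs xK; rewrite -/(u K) => h.
  apply: (@lt_le_trans _ _ (s * (lam / (4 * kap ^+ 2)))); last by rewrite ler_wpM2l// ltW.
  rewrite (_ : s * _ = 2) ?ltr1n// /s; field; rewrite !gt_eqF//.
apply: ereal_inf_le.
exists (ereal_sup [set cap_compact p K W | K in [set K | compact K /\ K `<=` G]]).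
  by exists G.
apply: ge_ereal_sup => _ [K [cK KG] <-].
have [N KN] : exists N, K `<=` O N.
  by apply: (compact_increasing_cover cK oO mono) => x /KG[].
apply: (@le_trans _ _ (energy p W (s \*: u N))).
  apply: ereal_inf_lbound; exists (s \*: u N) => //; split.
    by apply: test_funZ; exact: (@test_sum_test_fun _ _ mu p q x0 r lam n0 r0 H phi hphi).
  by move=> x /KN /= /ltW.
have mW : measurable (W : set (borelRn R n)) by exact: measurable_open.
rewrite energyZ ?(ltW s0)//.
apply: (@le_trans _ _ ((s `^ p)%:E *
    (@energy_const R n p q H CW * lam * mass mu (eball x0 (2 * r)))%:E)%E).
  by rewrite lee_wpmul2l ?lee_fin ?powR_ge0//; exact: energy_test_sum.
rewrite -EFinM lee_fin (@le_trans _ _ (C * mass mu (eball x0 (2 * r)) * lam `^ (- q)))//; last first.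
  by rewrite !ler_wpM2r ?powR_ge0 ?mass_ge0// lerDl.
have elam : lam^-1 `^ p = lam `^ (- q) / lam.
  rewrite -powR_inv1 ?(ltW lam0)// -powRrM -powRD ?(gt_eqF lam0) ?implybT//.
  by congr (_ `^ _); rewrite pq; ring.
have es : s `^ p = (8 * kap ^+ 2) `^ p * (lam `^ (- q) / lam).
  by rewrite /s powRM ?elam ?invr_ge0 ?(ltW lam0) ?mulr_ge0 ?exprn_ge0 ?(ltW kap0).
rewrite es /C le_eqVlt; apply/orP; left; apply/eqP; field.
by rewrite gt_eqF.
Qed.

(** * A lower bound for the capacity of spheres *)
Section capacity_of_spheres.
Context {R : realType} {m : nat}.
Implicit Types (x z : 'rV[R]_m.+1) (y : 'rV[R]_m).

Lemma row_cons0 (t : R) y : (row_cons (t, y : borelRn R m) : 'rV[R]_m.+1) 0 ord0 = t.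
Proof.
have := row_consl (t, y : borelRn R m) 0.
by rewrite (_ : lshift m 0 = ord0)//; apply/val_inj.
Qed.

Lemma row_consS (t : R) y j :
  (row_cons (t, y : borelRn R m) : 'rV[R]_m.+1) 0 (lift ord0 j) = y 0 j.
Proof.
have := row_consr (t, y : borelRn R m) 0 j.
by rewrite (_ : rshift 1 j = lift ord0 j)//; apply/val_inj.
Qed.

Let coordB x z i : (x - z) 0 i = x 0 i - z 0 i. Proof. by rewrite !mxE. Qed.
Let coordD x z i : (x + z) 0 i = x 0 i + z 0 i. Proof. by rewrite !mxE. Qed.

Definition tail x : 'rV[R]_m := \row_j x 0 (lift ord0 j).

Lemma enorm_row_cons (t : R) y x :
  enorm ((row_cons (t, y : borelRn R m) : 'rV[R]_m.+1) - x) ^+ 2 =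
  (t - x 0 ord0) ^+ 2 + enorm (y - tail x) ^+ 2.
Proof.
rewrite !enorm_sqr big_ord_recl coordB row_cons0; congr (_ + _).
by apply: eq_bigr => j _; rewrite coordB row_consS !mxE.
Qed.

Lemma row_cons_line (t : R) y : (row_cons (t, y : borelRn R m) : 'rV[R]_m.+1) =
  t *: delta_mx 0 ord0 + (row_cons (0, y : borelRn R m) : 'rV[R]_m.+1).
Proof.
apply/rowP => i; rewrite coordD; case: (unliftP ord0 i) => [j|] ->.
  by rewrite !row_consS !mxE eq_sym (negbTE (neq_lift _ _)) andbF mulr0 add0r.
by rewrite !row_cons0 !mxE !eqxx mulr1 addr0.
Qed.

Lemma sphere_boundary x z (r : R) : 0 < r -> enorm (z - x) = r -> boundary (eball x r) z.
Proof.
move=> r0 zr; split; last first.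
  by move=> /interior_subset; rewrite /eball/= zr ltxx.
move=> B /nbhs_ballP[e /= e0 eB].
pose h : R := Num.min (2^-1) (e / (2 * r)).
have h0 : 0 < h by rewrite lt_min invr_gt0 ltr0n divr_gt0// mulr_gt0.
have h1 : h <= 2^-1 by rewrite ge_min lexx.
have h2 : h * r < e.
  rewrite (@le_lt_trans _ _ (e / 2))//; last by rewrite ltr_pdivrMr// ltr_pMr// ltr1n.
  rewrite -ler_pdivlMr// -mulrA -invfM ge_min; apply/orP; right.
  by rewrite le_eqVlt; apply/orP; left.
exists (z - h *: (z - x)); split.
  rewrite /eball/= (_ : _ - x = (1 - h) *: (z - x)); last first.
    by rewrite scalerBl scale1r addrAC.
  by rewrite enormZ zr ger0_norm ?subr_ge0; [rewrite gtr_pMl// ltrBlDr ltrDl|lra].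
apply: eB; split => // i j; rewrite !ord1 /ball/=.
rewrite (_ : _ - _ = h * (z 0 j - x 0 j)); last by rewrite !mxE; ring.
rewrite normrM gtr0_norm//.
rewrite (le_lt_trans _ h2)// ler_wpM2l ?(ltW h0)// -zr.
by have := coord_le_enorm (z - x) j; rewrite !mxE.
Qed.

(** Either a is at most 1 / lam or lam * a has a power at least 1. This replaces
the inequality of Hoelder in line_energy. *)
Lemma le_affine_powR (a lam p : R) : 1 < p -> 0 < lam -> 0 <= a ->
  a <= lam^-1 + lam `^ (p - 1) * a `^ p.
Proof.
move=> p1 l0 a0; have [al|al] := leP a lam^-1.
  by rewrite (le_trans al)// lerDl mulr_ge0 ?powR_ge0.
have la : 1 <= lam * a by rewrite mulrC -ler_pdivrMr// div1r ltW.
rewrite (@le_trans _ _ (lam `^ (p - 1) * a `^ p))//; last by rewrite lerDr invr_ge0 ltW.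
rewrite -(mulr_powRB1 a0); last by rewrite (lt_trans _ p1).
rewrite mulrCA -powRM ?(ltW l0)// ler_peMr//.
have : 1 `^ (p - 1) <= (lam * a) `^ (p - 1).
  by rewrite ge0_ler_powR ?subr_ge0 ?(ltW p1) ?nnegrE ?mulr_ge0 ?(ltW l0).
by rewrite powR1.
Qed.

Lemma grad_outside_supp (u : 'rV[R]_m.+1 -> R) x : ~ supp u x -> grad u x = 0.
Proof.
move=> xu; have oC : open (~` supp u) by apply: closed_openC; exact: closed_closure.
apply/rowP => i; rewrite !mxE /pderiv (@near_eq_derive _ _ _ u (cst 0)) ?derive_cst//.
have : nbhs x (~` supp u) by apply: open_nbhs_nbhs.
apply: filterS => y yu; apply/eqP/negPn/negP => h; apply: yu.
exact: subset_closure.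
Qed.

Lemma coord_grad (u : 'rV[R]_m.+1 -> R) x : `|pderiv ord0 u x| <= enorm (grad u x).
Proof. by have := coord_le_enorm (grad u x) ord0; rewrite mxE. Qed.

Section along_lines.
Variables (u : 'rV[R]_m.+1 -> R) (y : 'rV[R]_m) (p : R).
Hypothesis su : smooth u.

Let line (t : R) : 'rV[R]_m.+1 := row_cons (t, y : borelRn R m).

Lemma line_continuous : continuous line.
Proof.
rewrite (_ : line = (fun t => t *: delta_mx 0 ord0 + line 0)); last first.
  by apply/funext => t; exact: row_cons_line.
move=> t; apply: cvgD; last exact: cvg_cst.
by apply: cvgZr_tmp; exact: cvg_id.
Qed.

Lemma is_derive_line (t : R) : is_derive t 1 (u \o line) (pderiv ord0 u (line t)).
Proof.
have e : (fun h : R => h^-1 *: (((u \o line) \o shift t) (h *: (1 : R)) - (u \o line) t)) =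
    (fun h : R => h^-1 *: ((u \o shift (line t)) (h *: delta_mx 0 ord0) - u (line t))).
  apply/funext => h /=; congr (_ *: (u _ - _)).
  rewrite /line row_cons_line [in RHS]row_cons_line addrA -scalerDl.
  by rewrite /GRing.scale/= mulr1.
have du : derivable u (line t) (delta_mx 0 ord0) by apply: diff_derivable; exact: smooth_diff.
apply: DeriveDef; last by rewrite /pderiv /derive e.
by move: du; rewrite /derivable e.
Qed.

Hypothesis p_gt1 : 1 < p.

(** By the fundamental theorem of calculus the derivative of u along the line has
integral at most -1; le_affine_powR with lam = 4 r then absorbs half of it, as
the segment has length at most 2 r. *)
Lemma line_energy (a b r : R) : 0 < r -> a < b -> b - a <= 2 * r ->
  1 <= u (line a) -> u (line b) = 0 ->
  ((2^-1 * (4 * r) `^ (1 - p))%:E <=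
   \int[lebesgue_measure]_(t in `[a, b]) (enorm (grad u (line t)) `^ p)%:E)%E.
Proof.
move=> r0 ab bar ua ub; have p0 : 0 < p by rewrite (lt_trans ltr01).
pose f t := - pderiv ord0 u (line t).
have cul : continuous (u \o line).
  by move=> t; apply: continuous_comp; [exact: line_continuous|exact: smooth_continuous].
have cf : continuous f.
  move=> t; apply: cvgN; apply: continuous_comp; first exact: line_continuous.
  by apply: smooth_continuous; exact: smooth_pderiv.
have dF (t : R) : is_derive t 1 (fun t : R => - u (line t)) (f t).
  by apply: is_deriveN; exact: is_derive_line.
have ftc : (\int[lebesgue_measure]_(t in `[a, b]) (f t)%:E = (- u (line b))%:E - (- u (line a))%:E)%E.
  apply: (@continuous_FTC2 R f (fun t => - u (line t))) => //.
  - exact: continuous_subspaceT.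
  - split; first by move=> t _; have [] := dF t.
      by apply: cvg_at_right_filter; apply: cvgN; exact: cul.
    by apply: cvg_at_left_filter; apply: cvgN; exact: cul.
  - by move=> t _; rewrite derive1E; have [_ ->] := dF t.
have mF : measurable_fun (`[a, b]%classic : set R) (fun t => (enorm (grad u (line t)) `^ p)%:E).
  apply/measurable_EFinP; apply: measurable_funTS.
  have mg := measurable_grad_power p su.
  have ml := measurableT_comp mg (@measurable_row_cons R m).
  exact: (measurableT_comp ml (pair2_measurable (y : borelRn R m))).
have r4 : 0 < 4 * r by rewrite mulr_gt0.
pose K := (4 * r) `^ (p - 1).
have K0 : 0 < K by exact: powR_gt0.
have bound : ((u (line a))%:E <= ((4 * r)^-1 * (b - a))%:E + K%:E *
    \int[lebesgue_measure]_(t in `[a, b]) (enorm (grad u (line t)) `^ p)%:E)%E.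
  have -> : ((u (line a))%:E = \int[lebesgue_measure]_(t in `[a, b]) (f t)%:E)%E.
    by rewrite ftc ub oppr0 -EFinB sub0r opprK.
  rewrite integralE; apply: (@le_trans _ _ (\int[lebesgue_measure]_(t in `[a, b]) ((EFin \o f)^\+ t))%E).
    by rewrite -[leRHS]sube0; apply: leeB => //; apply: integral_ge0 => t _; exact: funeneg_ge0.
  apply: (@le_trans _ _ (\int[lebesgue_measure]_(t in `[a, b])
     (((4 * r)^-1)%:E + K%:E * (enorm (grad u (line t)) `^ p)%:E))%E).
    apply: ge0_le_integral_nomeas => t _; first exact: funepos_ge0.
    rewrite funeposE -EFinM -EFinD -EFin_max lee_fin ge_max.
    have G0 : 0 <= enorm (grad u (line t)) by exact: enorm_ge0.
    apply/andP; split.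
      rewrite (le_trans _ (le_affine_powR p_gt1 r4 G0))// (le_trans (ler_norm _))//.
      by rewrite normrN; exact: coord_grad.
    by rewrite addr_ge0 ?mulr_ge0 ?powR_ge0// ?invr_ge0 ltW.
  rewrite ge0_integralD//; last 3 first.
  - by move=> t _; rewrite lee_fin invr_ge0 ltW.
  - by move=> t _; rewrite mule_ge0// lee_fin ?powR_ge0// ltW.
  - exact: measurable_funeM.
  rewrite ge0_integralZl_EFin//; last 2 first.
  - by move=> t _; rewrite lee_fin powR_ge0.
  - exact: ltW.
  have lab : lebesgue_measure (`[a, b]%classic : set R) = (b - a)%:E.
    by rewrite lebesgue_measure_itv/= lte_fin ab.
  by rewrite integral_cst//; apply: leeD => //; rewrite EFinM -lab.
have half : (2^-1%:E <= K%:E * \int[lebesgue_measure]_(t in `[a, b]) (enorm (grad u (line t)) `^ p)%:E)%E.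
  have : (1%:E <= 2^-1%:E + K%:E *
    \int[lebesgue_measure]_(t in `[a, b]) (enorm (grad u (line t)) `^ p)%:E)%E.
    apply: (@le_trans _ _ (u (line a))%:E); first by rewrite lee_fin.
    apply: (le_trans bound); apply: leeD => //; rewrite lee_fin.
    by rewrite mulrC ler_pdivrMr// (le_trans bar)//; lra.
  set I := (K%:E * _)%E; case: I => [i| |]//=; last by move=> _; rewrite leey.
  by rewrite -EFinD !lee_fin; lra.
apply: (@le_trans _ _ (K^-1%:E * 2^-1%:E)%E).
  by rewrite -EFinM lee_fin mulrC /K -powRN opprB.
apply: (@le_trans _ _ (K^-1%:E * (K%:E *
   \int[lebesgue_measure]_(t in `[a, b]) (enorm (grad u (line t)) `^ p)%:E))%E).
  by rewrite lee_wpmul2l// lee_fin invr_ge0 ltW.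
by rewrite muleA -EFinM mulVf ?gt_eqF// mul1e.
Qed.

End along_lines.

(** Lines in the first coordinate direction through a small cube of one
dimension less meet the sphere, where u is at least 1, and then leave the larger ball,
where u vanishes; line_energy is integrated over that cube by Tonelli's theorem. *)
Theorem capacity_sphere_ge (p : R) : 1 < p -> exists2 c : R, 0 < c &
  forall x (r : R), 0 < r ->
  ((c * r `^ (m.+1%:R - p))%:E <= cap_compact p (boundary (eball x r)) (eball x (2 * r)))%E.
Proof.
move=> p1; exists (2^-1 * 4 `^ (1 - p) * m.+1%:R^-1 ^+ m).
  by rewrite !mulr_gt0 ?powR_gt0 ?exprn_gt0 ?invr_gt0.
move=> x r r0; apply: le_ereal_inf_tmp => _ [u [[su cu uD] u1] <-].
pose D : set 'rV[R]_m.+1 := eball x (2 * r).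
pose F z := (enorm (grad u z) `^ p)%:E.
have F0 z : (0 <= F z)%E by rewrite lee_fin powR_ge0.
have mF : measurable_fun [set: borelRn R m.+1] (F : borelRn R m.+1 -> \bar R).
  by apply/measurable_EFinP; exact: measurable_grad_power.
have offD z : ~ D z -> u z = 0.
  move=> zD; apply/eqP/negPn/negP => h; apply/zD/uD; exact: subset_closure.
have p0 : p != 0 by rewrite gt_eqF// (lt_trans ltr01).
have -> : energy p (eball x (2 * r)) u = (\int[lebesgue_Rn m.+1]_z F z)%E.
  rewrite /energy integral_mkcond; apply: eq_integral => z _; rewrite patchE.
  case: ifPn => //; rewrite notin_setE => zD.
  by rewrite /F (@grad_outside_supp u z) ?enorm0 ?powR0// => /uD.
have mG : measurable_fun [set: measurableTypeR R * borelRn R m] (F \o @row_cons R m).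
  exact: (measurableT_comp mF (@measurable_row_cons R m)).
have -> : (\int[lebesgue_Rn m.+1]_z F z =
    \int[lebesgue_measure \x lebesgue_Rn m]_z (F \o @row_cons R m) z)%E.
  exact: (ge0_integral_pushforward (@measurable_row_cons R m) _ measurableT mF (fun z _ => F0 z)).
rewrite fubini_tonelli2//; last by move=> z; exact: F0.
pose d : R := r / (2 * m.+1%:R).
have d0 : 0 < d by rewrite divr_gt0// mulr_gt0.
pose Y : set 'rV[R]_m := cube (tail x) d.
pose c : R := 2^-1 * (4 * r) `^ (1 - p).
have c0 : 0 <= c by rewrite mulr_ge0 ?powR_ge0.
have inner y : Y y -> (c%:E <= \int[lebesgue_measure]_t (F \o @row_cons R m) (t, y))%E.
  move=> Yy.
  have yr : enorm (y - tail x) <= r / 2.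
    rewrite (le_trans (enorm_cube Yy))// /d mulrA ler_pdivrMr ?mulr_gt0//.
    rewrite (_ : r / 2 * _ = r * m.+1%:R); last by field.
    by rewrite mulrC ler_pM2l// ler_nat.
  have y0 := enorm_ge0 (y - tail x).
  pose e := enorm (y - tail x).
  pose s := Num.sqrt (r ^+ 2 - e ^+ 2).
  have e2 : e ^+ 2 <= (r / 2) ^+ 2 by rewrite lerXn2r// nnegrE divr_ge0// ltW.
  have s2 : s ^+ 2 = r ^+ 2 - e ^+ 2.
    by rewrite sqr_sqrtr// subr_ge0 (le_trans e2)// lerXn2r ?nnegrE ?ltW// ?divr_gt0//; lra.
  have s0 : 0 <= s by exact: sqrtr_ge0.
  have sr : s <= r.
    by rewrite -(@ler_pXn2r _ 2)// ?nnegrE ?(ltW r0)// s2 gerBl sqr_ge0.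
  pose a := x 0 ord0 + s; pose b := x 0 ord0 + 2 * r.
  have ab : a < b by rewrite /a /b; lra.
  have bar : b - a <= 2 * r by rewrite /a /b; lra.
  have ua : 1 <= u (row_cons (a, y : borelRn R m)).
    apply: u1; apply: sphere_boundary => //.
    apply/eqP; rewrite -(@eqrXn2 _ 2)// ?enorm_ge0 ?(ltW r0)//.
    by rewrite enorm_row_cons /a addrAC subrr add0r s2 subrK.
  have ub : u (row_cons (b, y : borelRn R m)) = 0.
    apply: offD; rewrite /D /eball/= => h.
    have : enorm ((row_cons (b, y : borelRn R m) : 'rV[R]_m.+1) - x) ^+ 2 < (2 * r) ^+ 2.
      by rewrite ltrXn2r// ?enorm_ge0.
    rewrite enorm_row_cons /b addrAC subrr add0r ltNge => /negP; apply.
    by rewrite lerDl sqr_ge0.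
  apply: le_trans (line_energy su p1 r0 ab bar ua ub) _.
  have ms : measurable_fun [set: measurableTypeR R]
      (fun t : measurableTypeR R => (F \o @row_cons R m) (t, y)).
    exact: (measurableT_comp mG (pair2_measurable (y : borelRn R m))).
  exact: (ge0_subset_integral lebesgue_measure (measurable_itv `[a, b]) measurableT ms
    (fun t _ => F0 _) (@subsetT _ _)).
apply: (@le_trans _ _ (\int[lebesgue_Rn m]_y (c%:E * (\1_Y y)%:E))%E); last first.
  apply: ge0_le_integral_nomeas => y _; first by rewrite -EFinM lee_fin mulr_ge0.
  rewrite indicE; case: (boolP (y \in Y)) => [|_].
    by rewrite inE mule1 => /inner.
  by rewrite mule0; apply: integral_ge0 => t _; exact: F0.
rewrite ge0_integralZl_EFin//; last first.
  by apply/measurable_EFinP; apply: measurable_indic; exact: measurable_cube.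
rewrite integral_indic ?setIT//; last exact: measurable_cube.
have lY : lebesgue_Rn m Y = ((2 * d) ^+ m)%:E by apply: lebesgue_cube; exact: ltW.
apply: (@le_trans _ _ (c%:E * ((2 * d) ^+ m)%:E)%E); last by rewrite -lY.
rewrite -EFinM lee_fin le_eqVlt; apply/orP; left; apply/eqP.
rewrite /c /d powRM// ?(ltW r0)//.
have -> : r `^ (m.+1%:R - p) = r `^ (1 - p) * r ^+ m.
  rewrite -powR_mulrn ?(ltW r0)// -powRD ?(gt_eqF r0) ?implybT//.
  by congr (_ `^ _); rewrite -natr1; ring.
have -> : 2 * (r / (2 * m.+1%:R)) = r * m.+1%:R^-1 by field.
by rewrite exprMn; ring.
Qed.

End capacity_of_spheres.

(** * Wolff potentials and dyadic sums *)

Lemma nneseries_le (R : realType) (u : nat -> \bar R) (N : nat) (B : \bar R) :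
  (forall k, (N <= k)%N -> (0 <= u k)%E) ->
  (forall K, (\sum_(N <= k < K) u k <= B)%E) -> (\sum_(N <= k <oo) u k <= B)%E.
Proof.
move=> u0 uB; apply: lime_le; first by apply: is_cvg_nneseries => k Nk _; exact: u0.
by apply: nearW => K; exact: uB.
Qed.

Lemma ler_sum_rev (R : realType) (F G : nat -> R) J :
  (forall k, (k < J)%N -> F (J - k.+1)%N <= G k) ->
  \sum_(0 <= k < J) F k <= \sum_(0 <= k < J) G k.
Proof.
by move=> FG; rewrite big_nat_rev; apply: ler_sum_nat => k /andP[_ kJ]; rewrite add0n FG.
Qed.

Lemma dyadic_level (R : realType) (T t : R) : 0 < t <= T ->
  exists k, T / 2 ^+ k.+1 < t <= T / 2 ^+ k.
Proof.
move=> /andP[t0 tT]; have T0 : 0 < T by exact: lt_le_trans tT.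
have ex : exists k, T / 2 ^+ k < t.
  have [k hk] : exists k : nat, T / t < k%:R.
    by exists (Num.truncn (T / t)).+1; exact: truncnS_gt.
  exists k; rewrite ltr_pdivrMr ?exprn_gt0// mulrC -ltr_pdivrMr//.
  by rewrite (lt_le_trans hk)// -natrX ler_nat ltnW// ltn_expl.
case: (ex_minnP ex) => -[|k]; first by rewrite expr0 divr1 ltNge tT.
move=> kt kmin; exists k; rewrite kt/= leNgt; apply/negP => /kmin.
by rewrite ltnn.
Qed.

Section wolff_potential_bound.
Context {R : realType} {n : nat}.
Variables (mu : {finite_measure set (borelRn R n) -> \bar R}) (p q : R).
Hypothesis q_gt0 : 0 < q.
Hypothesis p_ltn : p < n%:R.
Hypothesis p_eq : p = q + 1.
Local Notation dens := (density mu p q).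
Let kap := @kappa R n p q.

Lemma wolff_integrand (x : 'rV[R]_n) (t : R) : 0 < t ->
  ((mu (eball x t) / (t `^ (n%:R - p))%:E) `^ (p - 1)^-1 / t%:E)%E = (dens x t / t)%:E.
Proof.
move=> t0; rewrite (mass_fin mu (measurable_eball x t)).
have a0 : 0 < t `^ (n%:R - p) by exact: powR_gt0.
rewrite inver gt_eqF// -EFinM poweR_EFin inver gt_eqF// -EFinM.
by rewrite /density p_eq addrK.
Qed.

(** On a dyadic interval of radii the density is at most kap times its value at
the right endpoint, and dt / t has mass at most 1. *)
Lemma wolff_le_dyadic (x : 'rV[R]_n) (r0 T B : R) : 0 < T -> r0 <= T ->
  (forall K, \sum_(0 <= k < K) dens x (T / 2 ^+ k) <= B) ->
  (wolff mu p x r0 <= (kap * B)%:E)%E.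
Proof.
move=> T0 r0T hB.
pose l k : R := T / 2 ^+ k.
have l0 k : 0 < l k by rewrite divr_gt0// exprn_gt0.
have lS k : l k = 2 * l k.+1 by rewrite /l exprS; field; rewrite expf_neq0.
have kap0 : 0 < kap by exact: kappa_gt0.
pose A k : R := kap * dens x (l k) / l k.+1.
have A0 k : 0 <= A k by rewrite !mulr_ge0 ?invr_ge0 ?density_ge0// ltW.
pose I k : set R := `]l k.+1, l k]%classic.
have mI k : measurable (I k) by exact: measurable_itv.
pose g (t : R) : \bar R := (\sum_(0 <= k <oo) (A k * \1_(I k) t)%:E)%E.
have term0 k t : (0 <= (A k * \1_(I k) t)%:E)%E by rewrite lee_fin mulr_ge0.
apply: (@le_trans _ _ (\int[lebesgue_measure]_(t in `]0%R, r0[) g t)%E).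
  apply: ge0_le_integral_nomeas => t /=; rewrite in_itv/= => /andP[t0 tr].
    by rewrite wolff_integrand// lee_fin divr_ge0 ?density_ge0// ltW.
  rewrite wolff_integrand//.
  have [k /andP[kt tk]] : exists k, l k.+1 < t <= l k.
    by apply: dyadic_level; rewrite t0 (le_trans (ltW tr)).
  apply: (@le_trans _ _ (\sum_(0 <= j < k.+1) (A j * \1_(I j) t)%:E)%E).
    rewrite big_nat_recr//= -[leLHS]add0e; apply: leeD.
      by apply: sume_ge0 => j _.
    rewrite indicE mem_set ?mulr1 ?lee_fin; last by rewrite /I/= in_itv/= kt tk.
    apply: ler_pM; [exact: density_ge0|by rewrite invr_ge0 ltW| |by rewrite lef_pV2 ?posrE// ltW].
    have le1 : mass mu (eball x t) <= mass mu (eball x (l k)).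
      apply: le_mass; [exact: measurable_eball|exact: measurable_eball|].
      by move=> y /= /lt_le_trans; apply.
    apply: le_trans (density_le p q_gt0 1 t0 le1) _.
    rewrite [kappa _ _ ^+ 1]expr1; apply: ler_wpM2l; first exact: ltW.
    rewrite /density.
    have pw a : 0 < a -> 0 < a `^ (n%:R - p) by exact: powR_gt0.
    rewrite ge0_ler_powR ?invr_ge0 ?(ltW q_gt0)// ?nnegrE ?divr_ge0 ?mass_ge0 ?powR_ge0//.
    have t2 : 0 < 2 ^+ 1 * t by rewrite mulr_gt0.
    rewrite ler_wpM2l ?mass_ge0// lef_pV2 ?posrE ?pw//.
    have lt2 : l k <= 2 ^+ 1 * t by rewrite lS expr1 ler_pM2l// ltW.
    by apply: ge0_ler_powR lt2; rewrite ?nnegrE ?subr_ge0 ltW.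
  by apply: nneseries_lim_ge => j _ _; exact: term0.
rewrite /g integral_nneseries//; last first.
  move=> k; apply/measurable_EFinP; apply: measurable_funM; first exact: measurable_cst.
  by apply: measurable_indic; exact: mI.
apply: nneseries_le => [k _|K].
  by apply: integral_ge0 => t _; exact: term0.
apply: (@le_trans _ _ (\sum_(0 <= k < K) (kap * dens x (l k))%:E)%E).
  apply: lee_sum => k _.
  under eq_integral do rewrite EFinM.
  rewrite ge0_integralZl_EFin//; last first.
    by apply/measurable_EFinP; apply: measurable_indic; exact: mI.
  rewrite integral_indic; [|exact: measurable_itv|exact: mI].
  apply: (@le_trans _ _ ((A k)%:E * lebesgue_measure (I k))%E).
    rewrite lee_wpmul2l ?lee_fin//; apply: le_measure; rewrite ?inE; [|exact: mI|exact: subIsetl].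
    by apply: measurableI; [exact: mI|exact: measurable_itv].
  rewrite /I lebesgue_measure_itv/= lte_fin [l k]lS ltr_pMl ?ltr1n// -EFinB -EFinM lee_fin.
  rewrite /A le_eqVlt; apply/orP; left; apply/eqP; rewrite -lS.
  by rewrite {2}[l k]lS; field; rewrite gt_eqF.
by rewrite sumEFin lee_fin -mulr_sumr ler_wpM2l// ltW.
Qed.

(** For a radius t at least r / 4, the ball of radius t around x lies in the one
of radius 5 t around x0, so the growth at x0 bounds the density by a negative
power of t, and the sum over dyadic t is geometric. *)
Lemma density_growth_sum (x0 : 'rV[R]_n) (m C1 : R) : 0 <= m -> m < n%:R - p -> 0 <= C1 ->
  (forall t, 0 < t -> mass mu (eball x0 t) <= C1 * t `^ m) ->
  exists2 C : R, 0 <= C & forall x r J, 0 < r -> enorm (x - x0) <= r ->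
  \sum_(0 <= j < J) dens x (2 ^+ j * (r / 4)) <= C * r `^ (- ((n%:R - p - m) / q)).
Proof.
move=> m0 mn C10 hC; pose b := (n%:R - p - m) / q.
have b0 : 0 < b by rewrite divr_gt0// subr_gt0.
pose g : R := 2 `^ (- b).
have g0 : 0 < g by exact: powR_gt0.
have g1 : g < 1.
  rewrite /g powRN invf_lt1 ?powR_gt0//.
  suff : 1 `^ b < 2 `^ b by rewrite powR1.
  by rewrite gt0_ltr_powR ?nnegrE// ltr1n.
pose D := (C1 * 5 `^ m) `^ q^-1.
have D0 : 0 <= D by exact: powR_ge0.
exists (D * 4 `^ b * (1 - g)^-1).
  by rewrite !mulr_ge0 ?powR_ge0// invr_ge0 subr_ge0 ltW.
move=> x r J r0 xr; rewrite -/b.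
have term j : dens x (2 ^+ j * (r / 4)) <= D * 4 `^ b * r `^ (- b) * g ^+ j.
  set t := 2 ^+ j * (r / 4).
  have t4 : r / 4 <= t by rewrite /t ler_peMl ?divr_ge0 ?(ltW r0)// exprn_ege1// ler1n.
  have t0 : 0 < t by rewrite (lt_le_trans _ t4)// divr_gt0.
  have mt : mass mu (eball x t) <= C1 * 5 `^ m * t `^ m.
    apply: (@le_trans _ _ (mass mu (eball x0 (5 * t)))).
      apply: le_mass; [exact: measurable_eball|exact: measurable_eball|].
      by apply: sub_eball; lra.
    by rewrite (le_trans (hC _ _)) ?mulr_gt0// powRM ?(ltW t0)// mulrA.
  have tE : t `^ (- b) = 4 `^ b * r `^ (- b) * g ^+ j.
    rewrite /t powRM ?divr_ge0 ?exprn_ge0 ?(ltW r0)// powRM ?invr_ge0 ?(ltW r0)//.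
    have -> : (2 ^+ j) `^ (- b) = g ^+ j :> R.
      by rewrite powR_exprn.
    have -> : (4^-1 : R) `^ (- b) = 4 `^ b.
      by rewrite -powR_inv1// -powRrM mulN1r opprK.
    by ring.
  have -> : D * 4 `^ b * r `^ (- b) * g ^+ j = D * t `^ (- b) by rewrite tE; ring.
  have pt : 0 < t `^ (n%:R - p) by exact: powR_gt0.
  apply: (@le_trans _ _ ((C1 * 5 `^ m * (t `^ m / t `^ (n%:R - p))) `^ q^-1)).
    have h : mass mu (eball x t) / t `^ (n%:R - p) <= C1 * 5 `^ m * (t `^ m / t `^ (n%:R - p)).
      by rewrite mulrA ler_wpM2r// invr_ge0 ltW.
    apply: ge0_ler_powR h; rewrite ?nnegrE ?invr_ge0 ?(ltW q_gt0)//.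
      by rewrite mulr_ge0 ?invr_ge0 ?powR_ge0 ?mass_ge0.
    by rewrite !mulr_ge0 ?invr_ge0 ?powR_ge0.
  rewrite powRM ?mulr_ge0 ?invr_ge0 ?powR_ge0// ler_wpM2l//.
  rewrite -powRN -powRD ?(gt_eqF t0) ?implybT// -powRrM.
  rewrite (_ : (m + - (n%:R - p)) * q^-1 = - b)// /b; field.
  by rewrite gt_eqF.
apply: (@le_trans _ _ (\sum_(0 <= j < J) D * 4 `^ b * r `^ (- b) * g ^+ j)).
  by apply: ler_sum => j _; exact: term.
rewrite -mulr_sumr [leRHS]mulrAC ler_wpM2l ?mulr_ge0 ?powR_ge0//.
by apply: geometric_sum_le; rewrite g0 g1.
Qed.

(** The radii above r / 4 are left to the growth at x0; the smaller ones form the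
partial Wolff sums. *)
Lemma wolff_shell_le (x0 : 'rV[R]_n) (m C1 : R) : 0 <= m -> m < n%:R - p -> 0 <= C1 ->
  (forall t, 0 < t -> mass mu (eball x0 t) <= C1 * t `^ m) ->
  exists2 C : R, 0 <= C & forall x r r0 Q, 0 < r -> enorm (x - x0) <= r -> 0 < r0 ->
  (forall K, partial_wolff mu p q r x K <= Q) ->
  (wolff mu p x r0 <= (kap * (C * r `^ (- ((n%:R - p - m) / q)) + Q))%:E)%E.
Proof.
move=> m0 mn C10 hC.
have [C C0 hsum] := density_growth_sum m0 mn C10 hC.
exists C => // x r r0 Q r_gt0 xr r00 hQ.
have [J hJ] : exists J : nat, r0 / (r / 4) < J%:R.
  by exists (Num.truncn (r0 / (r / 4))).+1; exact: truncnS_gt.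
pose T := 2 ^+ J * (r / 4).
have r40 : 0 < r / 4 by rewrite divr_gt0.
apply: (@wolff_le_dyadic x r0 T).
- by rewrite mulr_gt0// exprn_gt0.
- rewrite /T -ler_pdivrMr// (le_trans (ltW hJ))// -natrX ler_nat ltnW//.
  exact: ltn_expl.
move=> K; pose F k := dens x (T / 2 ^+ k).
have F0 k : 0 <= F k by exact: density_ge0.
apply: (@le_trans _ _ (\sum_(0 <= k < K.+1 + J) F k)).
  rewrite [leRHS](@big_cat_nat _ _ _ K)//= ?lerDl ?sumr_ge0//.
  by rewrite addSn leqW// leq_addr.
rewrite (@big_cat_nat _ _ _ J)//= ?leq_addl//; apply: lerD.
  apply: le_trans (hsum x r J.+1 r_gt0 xr).
  rewrite [leRHS]big_nat_recl; last exact: leq0n.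
  apply: (@le_trans _ _ (\sum_(0 <= j < J) dens x (2 ^+ j.+1 * (r / 4)))); last first.
    by rewrite lerDr; exact: density_ge0.
  apply: ler_sum_rev => k kJ.
  have e : T / 2 ^+ (J - k.+1) = 2 ^+ k.+1 * (r / 4).
    by rewrite /T -{1}(subnK kJ) exprD; field; rewrite expf_neq0.
  by rewrite /F e.
rewrite -{1}(add0n J) big_addn addnK; apply: le_trans (hQ K).
rewrite le_eqVlt; apply/orP; left; apply/eqP; apply: eq_bigr => k _.
rewrite /F /T /len; congr density; rewrite exprD; field.
by rewrite !expf_neq0.
Qed.

End wolff_potential_bound.

(** * Capacities of the exceptional set *)
Section capacity_monotone.
Context {R : realType} {n : nat}.
Implicit Types (D F K : set 'rV[R]_n).

Lemma energy_ge0 (p : R) D (u : 'rV[R]_n -> R) : (0 <= energy p D u)%E.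
Proof. by apply: integral_ge0 => x _; rewrite lee_fin powR_ge0. Qed.

Lemma cap_ge0 (p : R) F D : (0 <= cap p F D)%E.
Proof.
apply: le_ereal_inf_tmp => _ [G _ <-].
apply: (@le_trans _ _ (cap_compact p set0 D)).
  by apply: le_ereal_inf_tmp => _ [u _ <-]; exact: energy_ge0.
by apply: ereal_sup_ubound; exists set0 => //; split; [exact: compact0|exact: sub0set].
Qed.

Lemma le_cap (p : R) F F' D : F `<=` F' -> (cap p F D <= cap p F' D)%E.
Proof.
move=> FF'; apply: le_ereal_inf => _ [G [oG F'G GD] <-].
by exists G => //; split => //; exact: subset_trans F'G.
Qed.

End capacity_monotone.

Lemma lee_div (R : realType) (x y : \bar R) (a b : R) :
  (0 <= x)%E -> (x <= a%:E)%E -> 0 < b -> (b%:E <= y)%E -> (x / y <= (a / b)%:E)%E.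
Proof.
move=> x0 xa b0; have a0 : 0 <= a by rewrite -lee_fin (le_trans x0).
case: y => [y| |] //; last first.
  by move=> _; rewrite invey mule0 lee_fin divr_ge0// ltW.
rewrite lee_fin => yb; have y0 : 0 < y by exact: lt_le_trans yb.
rewrite inver gt_eqF// EFinM; apply: lee_pmul => //.
  by rewrite lee_fin invr_ge0 ltW.
by rewrite lee_fin lef_pV2.
Qed.

(** For large radii the total mass of the measure takes over. *)
Lemma global_growth (R : realType) (n : nat) (mu : {finite_measure set (borelRn R n) -> \bar R})
    (x0 : 'rV[R]_n) (m r1 C0 : R) : 0 < m -> 0 < r1 -> 0 < C0 ->
  (forall t : R, 0 < t < r1 -> (mu (eball x0 t) <= (C0 * t `^ m)%:E)%E) ->
  exists2 C1 : R, 0 < C1 & forall t, 0 < t -> mass mu (eball x0 t) <= C1 * t `^ m.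
Proof.
move=> m0 r10 C00 growth.
have M0 : 0 <= mass mu setT by exact: mass_ge0.
have pr : 0 < r1 `^ m by exact: powR_gt0.
exists (C0 + mass mu setT / r1 `^ m).
  by rewrite ltr_wpDr// divr_ge0// ltW.
move=> t t0; have [tr|tr] := ltP t r1.
  rewrite (@le_trans _ _ (C0 * t `^ m))//.
    by rewrite -lee_fin -(mass_fin mu (measurable_eball x0 t)) growth// t0.
  by rewrite ler_wpM2r ?powR_ge0// lerDl divr_ge0// ltW.
rewrite (@le_trans _ _ (mass mu setT))//.
  by apply: le_mass => //; exact: measurable_eball.
rewrite mulrDl ler_wpDl ?mulr_ge0 ?powR_ge0 ?(ltW C00)//.
rewrite mulrAC ler_pdivlMr// ler_wpM2l//.
by apply: ge0_ler_powR tr; rewrite ?nnegrE ltW// ltW.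
Qed.

(* The measure mu on Omega is extended by zero outside Omega.  In the
   conclusion, dividing by 0 at x = x0 gives +oo in the extended reals. *)
Theorem theorem1p2p1 (R : realType) (n : nat) (p : R) (Omega : set 'rV[R]_n)
    (mu : {finite_measure set (borelRn R n) -> \bar R})
    (x0 : 'rV[R]_n) (m r0 C0 : R)
    (n_ge3 : (3 <= n)%N)
    (p_ge2_ltn : 2 <= p < n%:R)
    (Omega_open : open Omega)
    (Omega_bounded : bounded_set Omega)
    (mu_radon : radon mu)
    (mu_out : mu (~` Omega) = 0%E)
    (Omega_x0 : Omega x0)
    (m_bounds : 0 < m < n%:R - p)
    (r0_gt0 : 0 < r0)
    (ball_sub : eball x0 (3 * r0) `<=` Omega)
    (C0_gt0 : 0 < C0)
    (mu_growth : forall t : R, 0 < t < 3 * r0 ->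
       (mu (eball x0 t) <= (C0 * t `^ m)%:E)%E) :
  exists eps0 : R, 0 < eps0 /\
    forall eps : R, 0 < eps < eps0 ->
      exists (E : set 'rV[R]_n) (C : R),
        [/\ E `<=` Omega, p_thin p E x0, 0 < C &
            forall x : 'rV[R]_n, (Omega `\` E) x ->
              (wolff mu p x r0 <=
               C%:E / (enorm (x - x0) `^ ((n%:R - p - m + eps) / (p - 1)))%:E)%E].
Proof.
have /andP[p2 pn] := p_ge2_ltn; have /andP[m0 mn] := m_bounds.
exists 1; split => // eps /andP[eps0 _].
pose q : R := p - 1.
have q1 : 1 <= q by rewrite /q; lra.
have q0 : 0 < q by exact: lt_le_trans q1.
have pq : p = q + 1 by rewrite /q subrK.
have n0 : (0 < n)%N by exact: leq_trans n_ge3.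
have n_eq : n = n.-1.+1 by rewrite prednK.
have [C1 C10 growth] := global_growth m0 (mulr_gt0 (ltr0n R 3) r0_gt0) C0_gt0 mu_growth.
have [CT CT0 weak] := capacity_weak_type n0 q1 pn pq.
have [CW CW0 shell_le] := @wolff_shell_le R n mu p q q0 pn pq x0 m C1 (ltW m0) mn (ltW C10) growth.
have [c c0 den] : exists2 c : R, 0 < c & forall (x : 'rV[R]_n) (r : R), 0 < r ->
    ((c * r `^ (n%:R - p))%:E <= cap_compact p (boundary (eball x r)) (eball x (2 * r)))%E.
  have p1 : 1 < p by lra.
  by have [c c0 hc] := @capacity_sphere_ge R n.-1 p p1; exists c => //; move: hc; rewrite -n_eq.
pose kap := @kappa R n p q.
have kap0 : 0 < kap by exact: kappa_gt0.
pose b := (n%:R - p - m) / q; pose be := (n%:R - p - m + eps) / q.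
have b0 : 0 < b by rewrite divr_gt0// subr_gt0.
have bbe : b <= be by rewrite ler_pM2r ?invr_gt0// lerDl ltW.
have be0 : 0 < be by exact: lt_le_trans bbe.
pose D := (C1 * 2 `^ m * 4 `^ (n%:R - p)) `^ q^-1.
have D0 : 0 <= D by exact: powR_ge0.
(* The choice of L makes the coarsest density small, as capacity_weak_type asks. *)
pose L := 4 * kap * (D + 1).
have L0 : 0 < L by rewrite !mulr_gt0// ltr_wpDl.
pose C := kap * (CW + L).
have C_gt0 : 0 < C by rewrite mulr_gt0// ltr_wpDl.
(* The exceptional set is the set where the estimate fails; on the shell of radius
   rad i it lies where some partial Wolff sum exceeds a multiple of lam i. *)
pose E : set 'rV[R]_n := [set x | Omega x /\
  ~ (wolff mu p x r0 <= C%:E / (enorm (x - x0) `^ be)%:E)%E].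
pose rad (i : nat) : R := 2 ^- i.
have rad0 i : 0 < rad i by rewrite invr_gt0 exprn_gt0.
have rad1 i : rad i <= 1 by rewrite invf_le1 ?exprn_gt0// exprn_ege1// ler1n.
have rad_mono (r s t : R) : 0 < r -> r <= 1 -> s <= t -> r `^ (- s) <= r `^ (- t).
  by move=> r_gt0 r_le1 st; apply: ger_powR; rewrite ?r_gt0// lerN2.
pose lam i := L * rad i `^ (- be).
have lam0 i : 0 < lam i by rewrite mulr_gt0// powR_gt0.
have massE i : mass mu (eball x0 (2 * rad i)) <= C1 * 2 `^ m * rad i `^ m.
  by rewrite (le_trans (growth _ _)) ?mulr_gt0// powRM ?(ltW (rad0 i))// mulrA.
have small i : (mass mu (eball x0 (2 * rad i)) / (rad i / 4) `^ (n%:R - p)) `^ q^-1 <= lam i / (4 * kap).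
  have r0' := rad0 i; have pr := powR_gt0 (n%:R - p) r0'.
  have h : mass mu (eball x0 (2 * rad i)) / (rad i / 4) `^ (n%:R - p) <=
      C1 * 2 `^ m * 4 `^ (n%:R - p) * (rad i `^ m / rad i `^ (n%:R - p)).
    have -> : (rad i / 4) `^ (n%:R - p) = rad i `^ (n%:R - p) / 4 `^ (n%:R - p).
      have e4 : (4^-1 : R) `^ (n%:R - p) = (4 `^ (n%:R - p))^-1.
        by rewrite -powR_inv1// -powRrM mulN1r powRN.
      by rewrite powRM ?invr_ge0 ?(ltW r0')// e4.
    rewrite invf_div mulrCA mulrC [leRHS](_ : _ = C1 * 2 `^ m * rad i `^ m *
      (4 `^ (n%:R - p) / rad i `^ (n%:R - p))); last by ring.
    by rewrite mulrAC -mulrA ler_wpM2r ?divr_ge0 ?powR_ge0.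
  apply: (@le_trans _ _ (D * rad i `^ (- b))).
    apply: (@le_trans _ _ ((C1 * 2 `^ m * 4 `^ (n%:R - p) *
        (rad i `^ m / rad i `^ (n%:R - p))) `^ q^-1)).
      apply: ge0_ler_powR h; rewrite ?nnegrE ?invr_ge0 ?(ltW q0)//.
        by rewrite mulr_ge0 ?invr_ge0 ?powR_ge0 ?mass_ge0.
      by rewrite !mulr_ge0 ?invr_ge0 ?powR_ge0// ltW.
    rewrite powRM ?mulr_ge0 ?invr_ge0 ?powR_ge0 ?(ltW C10)// ler_wpM2l//.
    rewrite -powRN -powRD ?(gt_eqF r0') ?implybT// -powRrM.
    rewrite (_ : (m + - (n%:R - p)) * q^-1 = - b)// /b; field.
    by rewrite gt_eqF.
  rewrite /lam /L (_ : _ / _ = (D + 1) * rad i `^ (- be)); last by field; rewrite gt_eqF.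
  by apply: ler_pM; rewrite ?powR_ge0 ?lerDl//; exact: rad_mono.
exists E, C; split => //; [by move=> x []| |]; last first.
  by move=> x [Ox nE]; apply: contrapT => h; apply: nE.
have annE i : E `&` annulus x0 i `<=` [set x | shell x0 (rad i) x /\
    exists K, lam i / (2 * kap) < partial_wolff mu p q (rad i) x K].
  move=> x [[Ox hx] /andP[xl xr]]; split.
    by apply/andP; split => //; rewrite /rad -invfM mulrC -exprS.
  apply: contrapT => noK; apply: hx.
  have hK K : partial_wolff mu p q (rad i) x K <= lam i / (2 * kap).
    by rewrite leNgt; apply/negP => h; apply: noK; exists K.
  have xpos : 0 < enorm (x - x0) by apply: lt_le_trans xl; rewrite invr_gt0 exprn_gt0.
  rewrite inver gt_eqF ?powR_gt0// -EFinM.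
  apply: le_trans (shell_le x (rad i) r0 _ (rad0 i) xr r0_gt0 hK) _.
  have rx : rad i `^ (- be) <= enorm (x - x0) `^ (- be).
    rewrite !powRN lef_pV2 ?posrE ?powR_gt0//.
    by apply: ge0_ler_powR xr; rewrite ?nnegrE ltW.
  rewrite lee_fin /C -powRN -[leRHS]mulrA ler_wpM2l ?(ltW kap0)// [leRHS]mulrDl; apply: lerD.
    by rewrite ler_wpM2l// -/b (le_trans (rad_mono _ _ _ (rad0 i) (rad1 i) bbe)).
  apply: (@le_trans _ _ (lam i)).
    rewrite ler_pdivrMr ?mulr_gt0// ler_peMr ?(ltW (lam0 i))//.
    by have := kappa_ge1 q0 pn; rewrite -/kap => ?; lra.
  by rewrite /lam ler_wpM2l// ltW.
(* The ratios of capacities decay like rad i `^ eps, a geometric sequence. *)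
pose g : R := 2 `^ (- eps).
have g0 : 0 < g by exact: powR_gt0.
have g1 : g < 1.
  rewrite /g powRN invf_lt1 ?powR_gt0//.
  suff : 1 `^ eps < 2 `^ eps by rewrite powR1.
  by rewrite gt0_ltr_powR ?nnegrE// ltr1n.
pose X := CT * (C1 * 2 `^ m) * L `^ (- q) / c.
have X0 : 0 <= X by rewrite !mulr_ge0 ?powR_ge0 ?invr_ge0 ?(ltW CT0) ?(ltW C10) ?(ltW c0).
have ratio i : (cap p (E `&` annulus x0 i) (wide_annulus x0 i) /
      cap_compact p (boundary (eball x0 (2 ^- i))) (eball x0 (2 * 2 ^- i)) <= (X * g ^+ i)%:E)%E.
  pose a := CT * (C1 * 2 `^ m * rad i `^ m) * lam i `^ (- q).
  have wideE : wide_annulus x0 i = [set y | rad i / 4 < enorm (y - x0) < 2 * rad i].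
    rewrite /wide_annulus (_ : 2 ^- i.+2 = rad i / 4)// /rad !exprS.
    by field; rewrite expf_neq0.
  have num : (cap p (E `&` annulus x0 i) (wide_annulus x0 i) <= a%:E)%E.
    rewrite wideE; apply: le_trans (le_cap p _ (@annE i)) _.
    apply: le_trans (weak mu x0 (rad i) (lam i) (rad0 i) (lam0 i) (small i)) _.
    by rewrite lee_fin /a ler_wpM2r ?powR_ge0// ler_wpM2l ?(ltW CT0).
  have cr : 0 < c * rad i `^ (n%:R - p) by rewrite mulr_gt0// powR_gt0.
  apply: le_trans (lee_div (cap_ge0 p _ _) num cr (den x0 (rad i) (rad0 i))) _.
  rewrite lee_fin le_eqVlt; apply/orP; left; apply/eqP.
  have r0' := rad0 i; have pr := powR_gt0 (n%:R - p) r0'.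
  have lamE : lam i `^ (- q) = L `^ (- q) * rad i `^ (n%:R - p - m + eps).
    rewrite /lam powRM ?powR_ge0 ?(ltW L0)// -powRrM.
    by congr (_ * _ `^ _); rewrite /be; field; rewrite gt_eqF.
  have gE : g ^+ i = rad i `^ eps.
    rewrite /g /rad -powR_mulrn ?powR_ge0// -powRrM -exprVn -powR_mulrn ?invr_ge0// -powRrM.
    rewrite -powR_inv1// -powRrM.
    by congr (_ `^ _); ring.
  have rE : rad i `^ m * rad i `^ (n%:R - p - m + eps) = rad i `^ (n%:R - p) * rad i `^ eps.
    rewrite -!powRD ?(gt_eqF r0') ?implybT//.
    by congr (_ `^ _); ring.
  have -> : a = CT * (C1 * 2 `^ m) * L `^ (- q) * (rad i `^ m * rad i `^ (n%:R - p - m + eps)).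
    by rewrite /a lamE; ring.
  rewrite rE gE /X; field.
  by rewrite !gt_eqF.
rewrite /p_thin; apply: (@le_lt_trans _ _ (X * (1 - g)^-1)%:E); last exact: ltry.
have den_ge0 i : (0 <= cap_compact p (boundary (eball x0 (2 ^- i))) (eball x0 (2 * 2 ^- i)))%E.
  by apply: le_trans (den x0 (rad i) (rad0 i)); rewrite lee_fin mulr_ge0 ?powR_ge0// ltW.
apply: nneseries_le => [k _|K].
  by rewrite mule_ge0 ?cap_ge0// inve_ge0.
apply: (@le_trans _ _ (\sum_(1 <= i < K) (X * g ^+ i)%:E)%E).
  by apply: lee_sum => i _; exact: ratio.
rewrite sumEFin lee_fin -mulr_sumr ler_wpM2l//.
have [K0|K0] := posnP K.
  by rewrite K0 big_geq// invr_ge0 subr_ge0 ltW.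
apply: (@le_trans _ _ (\sum_(0 <= i < K) g ^+ i)).
  by rewrite [leRHS](@big_cat_nat _ _ _ 1)//= ler_wpDl// big_nat1 expr0.
by apply: geometric_sum_le; rewrite g0 g1.
Qed.
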